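(* Assume $\operatorname{zer}(A+B)\neq\varnothing$. Let $(\gamma_n)$ be a nondecreasing sequence in $\big]0,\frac{\sqrt2-1}{\mu}\big[$ such that $$\tau=\inf_{n\in\mathbb N}\Big(\frac2{\gamma_n}-\frac1{\gamma_{n-1}}-\mu(1+\sqrt2)\Big)>0.$$ Let $(x_n)$ be generated by the reflected stochastic forward–backward iteration with these step sizes, and assume that $$\sum_{n\in\mathbb N}\mathsf E\big[\|r_n-By_n\|^2\mid\mathcal F_n\big]<+\infty\quad\text{a.s.}$$ Then $(x_n)$ converges weakly almost surely to a random variable $\bar x:\Omega\to\operatorname{zer}(A+B)$.
   Context: $\mathcal H$ is a separable real Hilbert space; $(\Omega,\mathcal F,\mathsf P)$ a probability space. $A:\mathcal H\to2^{\mathcal H}$ is maximally monotone; $B:\mathcal H\to\mathcal H$ is monotone and $\mu$-Lipschitz continuous ($\mu>0$); $\operatorname{zer}(A+B)=\{x:0\in Ax+Bx\}$. $J_{\gamma A}=(\mathrm{Id}+\gamma A)^{-1}$. Reflected stochastic forward–backward iteration: $(\gamma_n)_{n\ge-1}$ is a sequence in $]0,+\infty[$, $x_0,x_{-1}$ are square-integrable $\mathcal H$-valued random variables, and for every $n\in\mathbb N$: $y_n=2x_n-x_{n-1}$; $r_n$ is an $\mathcal H$-valued random variable with $\mathsf E[r_n\mid\mathcal F_n]=By_n$, where $\mathcal F_n=\sigma(x_0,\dots,x_n)$; and $x_{n+1}=J_{\gamma_nA}(x_n-\gamma_nr_n)$. *)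

(* Defs.v *)
From HB Require Import structures.
From mathcomp Require Import all_boot all_order all_algebra.
From mathcomp Require Import all_classical all_reals all_analysis.
From mathcomp Require Import measurable_realfun.
Set Implicit Arguments. Unset Strict Implicit. Unset Printing Implicit Defensive.
Import Order.TTheory GRing.Theory Num.Theory.
Import numFieldNormedType.Exports.
Local Open Scope classical_set_scope.
Local Open Scope ring_scope.

Definition inner_product {R : realType} {H : normedModType R} (ip : H -> H -> R) :=
  [/\ (forall x y, ip x y = ip y x),
      (forall a x y z, ip (a *: x + y) z = a * ip x z + ip y z)
    & (forall x, ip x x = `|x| ^+ 2)].

Definition separable {R : realType} {H : normedModType R} :=
  exists D : set H, countable D /\ closure D = setT.

Definition sep_hilbert {R : realType} {H : completeNormedModType R}
  (ip : H -> H -> R) := inner_product ip /\ @separable R H.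

Definition set_monotone {R : realType} {H : normedModType R}
  (ip : H -> H -> R) (A : H -> set H) :=
  forall x y u v, A x u -> A y v -> 0 <= ip (x - y) (u - v).

Definition maximally_monotone {R : realType} {H : normedModType R}
  (ip : H -> H -> R) (A : H -> set H) :=
  set_monotone ip A /\
  forall A' : H -> set H, set_monotone ip A' ->
    (forall x, A x `<=` A' x) -> A' = A.

Definition monotone_op {R : realType} {H : normedModType R}
  (ip : H -> H -> R) (B : H -> H) :=
  forall x y, 0 <= ip (x - y) (B x - B y).

Definition lipschitz_op {R : realType} {H : normedModType R} (mu : R) (B : H -> H) :=
  forall x y, `|B x - B y| <= mu * `|x - y|.

Definition zer {R : realType} {H : normedModType R} (A : H -> set H) (B : H -> H)
  : set H := [set x | exists2 a, A x a & a + B x = 0].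

Definition resolvent {R : realType} {H : normedModType R}
  (gamma : R) (A : H -> set H) (z p : H) :=
  exists2 a, A p a & z = p + gamma *: a.

Definition borel_meas_wrt {d} {Omega : measurableType d} {R : realType}
  {H : normedModType R} (G : set (set Omega)) (X : Omega -> H) :=
  forall U : set H, open U -> G (X @^-1` U).

Definition H_rv {d} {Omega : measurableType d} {R : realType}
  {H : normedModType R} (X : Omega -> H) :=
  borel_meas_wrt (@measurable d Omega) X.

Definition sq_integrable {d} {Omega : measurableType d} {R : realType}
  {H : normedModType R} (P : probability Omega R) (X : Omega -> H) :=
  H_rv X /\ P.-integrable setT (fun w => (`|X w| ^+ 2)%:E).

Definition natural_filtration {d} {Omega : measurableType d} {R : realType}
  {H : normedModType R} (X : nat -> Omega -> H) (n : nat) : set (set Omega) :=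
  <<s [set S | exists k, exists U : set H, [/\ (k <= n)%N, open U & S = X k @^-1` U]] >>.

(* Y = E[X | G] for Bochner-integrable H-valued X, stated weakly:
   Y is G-measurable and integrable, and for every h and every S in G,
   int_S <X,h> dP = int_S <Y,h> dP. *)
Definition condexp_H {d} {Omega : measurableType d} {R : realType}
  {H : normedModType R} (ip : H -> H -> R) (P : probability Omega R)
  (G : set (set Omega)) (X Y : Omega -> H) :=
  [/\ H_rv X, P.-integrable setT (fun w => (`|X w|)%:E),
      borel_meas_wrt G Y, P.-integrable setT (fun w => (`|Y w|)%:E)
    & forall h S, G S ->
      (\int[P]_(w in S) (ip (X w) h)%:E = \int[P]_(w in S) (ip (Y w) h)%:E)%E].

Definition condexp_nneg {d} {Omega : measurableType d} {R : realType}
  (P : probability Omega R) (G : set (set Omega)) (f g : Omega -> \bar R) :=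
  [/\ (forall w, (0 <= g w)%E),
      (forall B : set (\bar R), measurable B -> G (g @^-1` B))
    & forall S, G S -> (\int[P]_(w in S) g w = \int[P]_(w in S) f w)%E].

Definition weak_cvg {R : realType} {H : normedModType R} (ip : H -> H -> R)
  (x : nat -> H) (xb : H) :=
  forall h, (fun n => ip (x n) h) @ \oo --> ip xb h.

Definition step_prev {T : Type} (xm1 : T) (x : nat -> T) (n : nat) : T :=
  if n is k.+1 then x k else xm1.

Definition refl_pt {T : Type} {R : realType} {H : normedModType R}
  (xm1 : T -> H) (x : nat -> T -> H) (n : nat) (w : T) : H :=
  2 *: x n w - step_prev (xm1 w) (x ^~ w) n.

(* Main.v *)
(* The Lyapunov function
     V_n = |x_n - z|^2 / g_(n-1) + (3 / g_(n-1) - 1 / g_(n-2)) |x_n - x_(n-1)|^2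
           + 2 <B y_(n-1) - B z, x_n - x_(n-1)> + mu |x_n - y_(n-1)|^2
   (g for gamma, z a zero of A + B) is adapted and dominates |x_n - z|^2, and
   monotonicity of A at (x_(n+1), z) and at (x_(n+1), x_n) gives, pathwise,
     V_(n+1) + (tau / 2) |x_n - x_(n-1)|^2 + 2 <e_n, w_n>
       <= V_n + (16 / tau) (|e_n|^2 + |e_(n-1)|^2)
   with e_n = r_n - B y_n and w_n adapted.  The noise e_n itself is not
   F_(n+1)-measurable, so this is only used integrated over events of F_n, where
   <e_n, w_n> disappears.  Stopping when the sum of the conditional variances
   exceeds m makes the right-hand side summable, and Doob's upcrossing argument
   gives almost sure convergence of V_n.  Hence |x_n - z| converges
   for all z in a countable dense subset of the zeros, and Opial's argument
   applies, the weak cluster points of (x_n) being zeros of A + B. *)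

Require Import Defs.
From HB Require Import structures.
From mathcomp Require Import all_boot all_order all_algebra.
From mathcomp Require Import all_classical all_reals all_analysis.
From mathcomp Require Import measurable_realfun.
From mathcomp Require Import ring lra.
Set Implicit Arguments. Unset Strict Implicit. Unset Printing Implicit Defensive.
Import Order.TTheory GRing.Theory Num.Theory.
Import numFieldNormedType.Exports.
Local Open Scope classical_set_scope.
Local Open Scope ring_scope.

(** * The Lyapunov inequality *)

(** The inequality must be tested event by event for a second reason: the conditional variance of
    e_(n-1) refers to F_(n-1), to which an event S of F_n need not belong. So |e_(n-1)|^2 is
    integrated over a larger event of F_(n-1) instead, which costs a number independent of S. This
    is why the almost supermartingales below carry deterministic errors. The r_n are only assumed to
    be integrable, so x_1 may fail to be square-integrable and the products <e_n, w_n> may fail to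
    be integrable. The former is met by also cutting off large initial values of V, the latter by
    working on a countable partition on which w_n is nearly constant. The first value of V in use is
    V_2, because x_(-1) does not enter the filtration. *)

Section InnerProduct.
Context {R : realType} {H : normedModType R} {ip : H -> H -> R}.
Hypothesis ipP : inner_product ip.

Lemma ipC x y : ip x y = ip y x.
Proof. by case: ipP => /(_ x y). Qed.

Lemma ipDl x y z : ip (x + y) z = ip x z + ip y z.
Proof. by case: ipP => _ /(_ 1 x y z); rewrite scale1r mul1r. Qed.

Lemma ip0l z : ip 0 z = 0.
Proof. by apply: (@addrI _ (ip 0 z)); rewrite -ipDl !addr0. Qed.

Lemma ipZl a x z : ip (a *: x) z = a * ip x z.
Proof. by case: ipP => _ /(_ a x 0 z); rewrite addr0 ip0l addr0. Qed.

Lemma ipNl x z : ip (- x) z = - ip x z.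
Proof. by rewrite -scaleN1r ipZl mulN1r. Qed.

Lemma ipDr x y z : ip z (x + y) = ip z x + ip z y.
Proof. by rewrite ipC ipDl !(ipC z). Qed.

Lemma ipZr a x z : ip z (a *: x) = a * ip z x.
Proof. by rewrite ipC ipZl (ipC z). Qed.

Lemma ipNr x z : ip z (- x) = - ip z x.
Proof. by rewrite ipC ipNl (ipC z). Qed.

Lemma ip0r z : ip z 0 = 0.
Proof. by rewrite ipC ip0l. Qed.

Definition ipE := (ipDl, ipDr, ipNl, ipNr, ipZl, ipZr).

Lemma ip_sqr x : `|x| ^+ 2 = ip x x.
Proof. by case: ipP => _ _ ->. Qed.

Lemma ip_ge0 x : 0 <= ip x x.
Proof. by rewrite -ip_sqr sqr_ge0. Qed.

Lemma ip_young (t : R) x y : 0 < t -> 2 * ip x y <= t * ip x x + t^-1 * ip y y.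
Proof.
move=> t0; have := ip_ge0 (t *: x - y); rewrite !ipE (ipC y x) => h.
rewrite -(ler_pM2l t0) mulrDr mulrA (mulrA t t^-1) divff ?gt_eqF// mul1r.
by nra.
Qed.

Lemma ip_cauchy_schwarz x y : `|ip x y| <= `|x| * `|y|.
Proof.
have [->|x0] := eqVneq x 0; first by rewrite ip0l !normr0 mul0r.
have x1 : 0 < `|x| by rewrite normr_gt0.
suff h z : ip x z <= `|x| * `|z|.
  by rewrite ler_norml h andbT lerNl -ipNr -(normrN y).
have [->|z0] := eqVneq z 0; first by rewrite ip0r !normr0 mulr0.
have z1 : 0 < `|z| by rewrite normr_gt0.
have := @ip_young (`|z| / `|x|) x z (divr_gt0 z1 x1).
rewrite -!ip_sqr invf_div.
have -> : `|z| / `|x| * `|x| ^+ 2 = `|z| * `|x| by field; rewrite gt_eqF.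
have -> : `|x| / `|z| * `|z| ^+ 2 = `|z| * `|x| by field; rewrite gt_eqF.
by rewrite (mulrC `|z|); lra.
Qed.

Lemma ip_le_norm x y : ip x y <= `|x| * `|y|.
Proof. exact: le_trans (ler_norm _) (ip_cauchy_schwarz x y). Qed.

Lemma ip_eq0 x : ip x x = 0 -> x = 0.
Proof. by move/eqP; rewrite -ip_sqr sqrf_eq0 normr_eq0 => /eqP. Qed.

Lemma ip_continuous (h : H) : continuous (ip ^~ h).
Proof.
move=> x; apply/cvgrPdist_lt => e e0; near=> y.
rewrite -ipNl -ipDl; apply: le_lt_trans (ip_cauchy_schwarz _ _) _.
rewrite (@le_lt_trans _ _ (`|x - y| * (`|h| + 1)))//.
  by rewrite ler_wpM2l// lerDl.
rewrite -ltr_pdivlMr ?ltr_wpDl//.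
near: y; apply: cvgr_dist_lt; first exact: cvg_id.
by rewrite divr_gt0// ltr_wpDl.
Unshelve. all: by end_near. Qed.

End InnerProduct.

Section Lyapunov.
Context {R : realType} {H : normedModType R} {ip : H -> H -> R}.
Hypothesis ipP : inner_product ip.
Let ipC := ipC ipP.
Let ipE := ipE ipP.

(* [b], [b'], [b''] stand for 1/gamma_n, 1/gamma_(n-1), 1/gamma_(n-2). *)
Definition lyap (mu b b' : R) (s u q' beta : H) : R :=
  b * ip s s + (3 * b - b') * ip u u + 2 * ip beta u + mu * ip q' q'.

(* With s = x_n - xs, u = x_n - x_(n-1), q' = x_n - y_(n-1) and
   beta' = B y_(n-1) - B xs. *)
Lemma lyap_ge (mu tau b b' : R) (s u q' beta' : H) :
  0 < mu -> 0 < tau -> mu * (1 + Num.sqrt 2) <= b ->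
  tau + mu * (1 + Num.sqrt 2) <= 2 * b - b' ->
  `|beta'| <= mu * `|s - q'| ->
  mu * ip s s <= lyap mu b b' s u q' beta'.
Proof.
move=> mu0 tau0 hb hbb hbeta; rewrite /lyap.
have h2 : 1 < Num.sqrt (2 : R).
  by rewrite -[ltLHS]sqrtr1 ltr_sqrt// ltr1n.
set w := Num.sqrt 2 in hb hbb h2 *.
(* Here |s - q'| is the distance from y_(n-1) to the zero. The term in |q'|^2 is paid by the last
   summand of [lyap]. Since w > 1, [b] exceeds 2 mu, and [3 * b - b'], being (2 b - b') + b, exceeds
   3 mu. *)
have Y : - (2 * ip beta' u) <= mu * ip s s / 2 + mu * ip q' q' + 3 * mu * ip u u.
  have m0 := ltW mu0.
  have CS : - (2 * ip beta' u) <= 2 * (mu * (`|s| + `|q'|)) * `|u|.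
    have := ip_cauchy_schwarz ipP beta' u; rewrite ler_norml => /andP[h _].
    rewrite -mulrN -mulrA ler_pM2l//.
    rewrite lerNl; apply: le_trans h; rewrite lerN2 ler_wpM2r//.
    by apply: le_trans hbeta _; rewrite ler_wpM2l// ler_normB.
  apply: le_trans CS _; rewrite -!(ip_sqr ipP) -subr_ge0.
  suff -> : mu * `|s| ^+ 2 / 2 + mu * `|q'| ^+ 2 + 3 * mu * `|u| ^+ 2 -
    2 * (mu * (`|s| + `|q'|)) * `|u| =
    mu * ((`|s| - 2 * `|u|) ^+ 2 / 2 + (`|q'| - `|u|) ^+ 2).
    by rewrite mulr_ge0// addr_ge0// ?sqr_ge0// divr_ge0// ?sqr_ge0.
  by field.
have s0 := ip_ge0 ipP s; have u0 := ip_ge0 ipP u.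
have hbs : 2 * mu * ip s s <= b * ip s s.
  by rewrite ler_wpM2r//; nra.
have hbu : 3 * mu * ip u u <= (3 * b - b') * ip u u.
  by rewrite ler_wpM2r//; nra.
have ms : 0 <= mu * ip s s by rewrite mulr_ge0// ltW.
lra.
Qed.

(* One step of the iteration: s = x_n - xs, u = x_n - x_(n-1),
   v = x_(n+1) - x_n, q' = x_n - y_(n-1), beta = B y_n - B xs, e = r_n - B y_n
   (primes for the previous index).  The resolvent inclusion makes
   a = - b v - beta - e an element of A x_(n+1) + B xs. *)
Lemma lyap_step (mu tau b b' b'' : R) (s u v q' beta beta' e e' : H) :
  0 < mu -> 0 < tau -> b <= b' ->
  tau + mu * (1 + Num.sqrt 2) <= b' ->
  tau + mu * (1 + Num.sqrt 2) <= 2 * b' - b'' ->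
  `|beta - beta'| <= mu * `|u + q'| ->
  0 <= ip (s + u) beta ->
  0 <= ip (s + v) (- (b *: v) - beta - e) ->
  0 <= ip v (- (b *: v) - beta - e - (- (b' *: u) - beta' - e')) ->
  lyap mu b b' (s + v) v (v - u) beta + tau / 2 * ip u u
    + 2 * ip e (s + u + u)
  <= lyap mu b' b'' s u q' beta' + 16 / tau * (ip e e + ip e' e').
Proof.
move=> mu0 tau0 bb' hb hbb hbeta hB hA hAA.
have h2 : 1 < Num.sqrt (2 : R).
  by rewrite -[ltLHS]sqrtr1 ltr_sqrt// ltr1n.
have w2 : Num.sqrt (2 : R) ^+ 2 = 2 by rewrite sqr_sqrtr.
set w := Num.sqrt 2 in hb hbb h2 w2 *.
(* Origin of 1 + sqrt 2: the weight of |v - u|^2, raised by mu for the new last term of [lyap], and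
   the weight of |u|^2 should both equal mu (1 + w), the common budget of [b'] and [2 * b' - b''].
   Sharpness of the estimate then forces w^2 = 2. *)
have Y1 : - (2 * ip (beta - beta') (v - u)) <=
    mu * ((1 + w) * ip u u + ip q' q' + w * ip (v - u) (v - u)).
  have CS : - (2 * ip (beta - beta') (v - u)) <= 2 * (mu * (`|u| + `|q'|)) * `|v - u|.
    have := ip_cauchy_schwarz ipP (beta - beta') (v - u).
    rewrite ler_norml => /andP[h _].
    rewrite -mulrN -mulrA ler_pM2l//.
    rewrite lerNl; apply: le_trans h; rewrite lerN2 ler_wpM2r//.
    by apply: le_trans hbeta _; rewrite ler_wpM2l ?ler_normD// ltW.
  apply: le_trans CS _; rewrite -!(ip_sqr ipP) -subr_ge0.
  (* Young's inequality twice, with weights chosen so that the coefficient of |q'|^2 is 1 *)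
  have w0 : w != 0 by rewrite gt_eqF//; lra.
  have w12 : w <= 2 by nra.
  suff -> : mu * ((1 + w) * `|u| ^+ 2 + `|q'| ^+ 2 + w * `|v - u| ^+ 2) -
     2 * (mu * (`|u| + `|q'|)) * `|v - u| =
     mu * (w / 2 * (`|u| + `|q'| - w * `|v - u|) ^+ 2
           + (1 - w / 2) * ((1 + w) * `|u| - `|q'|) ^+ 2).
    by rewrite mulr_ge0 ?(ltW mu0)// addr_ge0// mulr_ge0 ?sqr_ge0//; lra.
  set x := `|u|; set y := `|q'|; set z := `|v - u|.
  apply/eqP; rewrite -subr_eq0; apply/eqP.
  transitivity (mu * (w ^+ 2 - 2) *
      (- (w / 2) * z ^+ 2 + (x + y) * z + w / 2 * x ^+ 2 - x * y)).
    by field.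
  by rewrite w2 subrr mulr0 mul0r.
(* The noise 2 <s + v, e> + 2 <v, e - e'> is 2 <s + 2 u, e>, whose direction is adapted, plus 4 <v -
   u, e> - 2 <v - u, e'> - 2 <u, e'>. Each of the last three costs tau / 4 times a square; the
   doubled [e] in [Y3] produces 16 / tau. *)
have t4 : 0 < 4 / tau by rewrite divr_gt0.
have t16 : 0 < 16 / tau by rewrite divr_gt0.
have Y2 := ip_young ipP e' (v - u) t4.
have Y3 := ip_young ipP (- (2 *: e)) (v - u) t4.
have Y4 := ip_young ipP e' u t4.
rewrite invf_div in Y2 Y3 Y4.
have s0 : 0 <= (b' - b) * ip s s by rewrite mulr_ge0 ?(ip_ge0 ipP)//; lra.
have q0 : 0 <= (b' - mu * w - tau / 2 - mu) * ip (v - u) (v - u).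
  by rewrite mulr_ge0 ?(ip_ge0 ipP)//; nra.
have u0 : 0 <= (2 * b' - b'' - mu * (1 + w) - tau) * ip u u.
  by rewrite mulr_ge0 ?(ip_ge0 ipP)//; nra.
have e0 : 0 <= (16 / tau) * ip e' e' - 2 * (4 / tau) * ip e' e'.
  by rewrite -mulrBl mulr_ge0 ?(ip_ge0 ipP)//; lra.
have u1 : 0 <= tau * ip u u by rewrite mulr_ge0 ?(ip_ge0 ipP)// ltW.
(* Twice [hA] plus twice [hAA], after polarizing <s + v, v> and <v, u>, contains b |s + v|^2 + (3 b
   - b') |v|^2 + 2 <beta, v>: the origin of the coefficients of [lyap]. In the rest, <s + u, beta>
   is dropped by [hB] and <beta', u> telescopes. *)
rewrite /lyap.
move: Y1 Y2 Y3 Y4 hB hA hAA s0 q0 u0 e0 u1; rewrite !ipE.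
rewrite ?(ipC v s) ?(ipC u s) ?(ipC v u) ?(ipC v beta) ?(ipC v beta')
  ?(ipC u beta) ?(ipC u beta') ?(ipC v e) ?(ipC u e) ?(ipC v e') ?(ipC u e')
  ?(ipC s e) ?(ipC s beta).
set t := tau^-1.
clear -tau0; move=> *.
nra.
Qed.

End Lyapunov.

(** * Weak limits along ultrafilters *)

Section UltraLimits.
Context {R : realType}.

Lemma ultra_map (T U : Type) (f : T -> U) (F : set_system T) :
  UltraFilter F -> UltraFilter (f @ F).
Proof.
move=> FU; split; first exact: fmap_proper_filter.
move=> G GF sFG; apply/seteqP; split=> [B GB|]; last exact: sFG.
have [//|FnB] := in_ultra_setVsetC (f @^-1` B) FU.
have GnB : G (~` B) by exact: sFG.
by have := filterI GB GnB; rewrite setICr => G0; case: (@filter_not_empty _ G _ (G0 _)).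
Qed.

Lemma ultra_bounded_cvg (T : Type) (f : T -> R) (F : set_system T) (M : R) :
  UltraFilter F -> (forall t, `|f t| <= M) -> exists l : R, f @ F --> l.
Proof.
move=> FU fM; have fFU := ultra_map f FU.
have := @segment_compact R (- M) M; rewrite compact_ultra => /(_ _ fFU).
case=> [|l [_ fl]]; last by exists l.
by apply: nearW => t /=; rewrite in_itv/= -ler_norml.
Qed.

(** Otherwise [F] and the complement of the preimage of some neighbourhood of [l] generate a proper
    filter, and an ultrafilter above it contradicts the hypothesis. Ultrafilters thus take the place
    of subsequences. *)
Lemma cvg_ultraP (T : Type) (U : topologicalType) (f : T -> U) (F : set_system T) (l : U) :
  ProperFilter F ->
  (forall G, UltraFilter G -> F `<=` G -> f @ G --> l) -> f @ F --> l.
Proof.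
move=> FF h; apply: contrapT => /existsNP[A /not_implyP[lA nFA]].
pose B := f @^-1` A.
have PF : ProperFilter [set C | exists2 D, F D & D `&` ~` B `<=` C].
  split.
    move=> [D FD DB]; apply: nFA; apply: (@filterS _ F _ D B) FD => t Dt.
    by apply: contrapT => nBt; have := DB t; apply.
  split.
  - by exists setT => //; exact: filterT.
  - move=> C1 C2 [D1 FD1 s1] [D2 FD2 s2]; exists (D1 `&` D2); first exact: filterI.
    by move=> t [[? ?] ?]; split; [apply: s1|apply: s2].
  - by move=> C1 C2 s [D FD sD]; exists D => // t /sD /s.
have [G [GU sG]] := ultraFilterLemma PF.
have GB : G B.
  by apply: (h G GU) lA => C FC; apply: sG; exists C => // t [].
have GnB : G (~` B) by apply: sG; exists setT; [exact: filterT|move=> t []].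
by have := filterI GB GnB; rewrite setICr => G0; case: (@filter_not_empty _ G _ (G0 _)).
Qed.

Context {H : completeNormedModType R} {ip : H -> H -> R}.
Hypothesis ipP : inner_product ip.
Let ipC := ipC ipP.
Let ipE := ipE ipP.

Lemma cvg_ipr (T : Type) (F : set_system T) (FF : Filter F) (x : T -> H) xb h :
  x @ F --> xb -> ip (x t) h @[t --> F] --> ip xb h.
Proof. by move=> xx; apply: (@cvg_comp _ _ _ x (ip ^~ h) _ _ _ xx); exact: (@ip_continuous _ _ _ ipP h xb). Qed.

(* The weak limit is the asymptotic centre, i.e. the minimizer of
   y |-> lim |x_t - y|^2; this replaces weak compactness and Riesz' theorem. *)
Lemma ultra_weak_limit (T : Type) (F : set_system T) (x : T -> H) (M : R) :
  UltraFilter F -> (forall t, `|x t| <= M) ->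
  exists xb, forall h, ip (x t) h @[t --> F] --> ip xb h.
Proof.
move=> FU xM.
have /choice[ell ellP] h : exists l : R, ip (x t) h @[t --> F] --> l.
  apply: (@ultra_bounded_cvg T _ F (M * `|h|)) => // t.
  by apply: le_trans (ip_cauchy_schwarz ipP _ _) _; rewrite ler_wpM2r.
have [c cP] : exists c : R, ip (x t) (x t) @[t --> F] --> c.
  apply: (@ultra_bounded_cvg T _ F (M ^+ 2)) => // t.
  rewrite -(ip_sqr ipP) ger0_norm ?sqr_ge0// lerXn2r ?nnegrE//.
  exact: le_trans (xM t).
have ellD y z : ell (y + z) = ell y + ell z.
  have : (fun t => ip (x t) (y + z)) @ F --> ell y + ell z.
    have -> : (fun t => ip (x t) (y + z)) = (fun t => ip (x t) y + ip (x t) z).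
      by apply/funext => t; rewrite (ipDr ipP).
    exact: (cvgD (ellP y) (ellP z)).
  by move=> h; exact: (cvg_unique _ (ellP (y + z)) h).
have ellZ a y : ell (a *: y) = a * ell y.
  have : (fun t => ip (x t) (a *: y)) @ F --> a * ell y.
    have -> : (fun t => ip (x t) (a *: y)) = (fun t => a * ip (x t) y).
      by apply/funext => t; rewrite (ipZr ipP).
    exact: (cvgMl_tmp (a := a) (ellP y)).
  by move=> h; exact: (cvg_unique _ (ellP (a *: y)) h).
(* [Phi y] is the limit of |x t - y|^2 along [F]. *)
pose Phi y := c - 2 * ell y + ip y y.
have Phi0 y : 0 <= Phi y.
  have cvPhi : (fun t => ip (x t) (x t) - 2 * ip (x t) y + ip y y) @ F --> Phi y.
    exact: (cvgD (cvgB cP (cvgMl_tmp (a := 2) (ellP y))) (cvg_cst (ip y y))).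
  apply: (cvgr_to_ge cvPhi).
  apply: nearW => t; have := ip_ge0 ipP (x t - y).
  by rewrite !ipE (ipC y); lra.
pose I := inf (range Phi).
have Iinf : has_inf (range Phi).
  by split; [exists (Phi 0), 0|exists 0 => _ [y _ <-]].
have Ile y : I <= Phi y by apply: ge_inf; [case: Iinf|exists y].
have /choice[y yP] (k : nat) : exists y, Phi y < I + k.+1%:R^-1.
  have k0 : 0 < k.+1%:R^-1 :> R by rewrite invr_gt0.
  have [_ [y _ <-] ?] := inf_adherent k0 Iinf.
  by exists y.
(* Parallelogram law: comparing [I] with [Phi] at the midpoint makes the minimizing sequence
   Cauchy. *)
have dist j k : `|y j - y k| ^+ 2 <= 2 * j.+1%:R^-1 + 2 * k.+1%:R^-1.
  have := Ile (2^-1 *: (y j + y k)).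
  have := yP j; have := yP k; rewrite /Phi !ellZ !ellD (ip_sqr ipP) !ipE (ipC (y k) (y j)).
  by move: (j.+1%:R^-1 : R) (k.+1%:R^-1 : R) => ej ek; lra.
have : cvg (y @ \oo).
  apply/cauchy_cvgP/cauchy_exP => e e0.
  have [N NP] : exists N : nat, 4 * N.+1%:R^-1 < e ^+ 2.
    exists (Num.trunc (4 / e ^+ 2)).
    rewrite ltr_pdivrMr// mulrC -ltr_pdivrMr ?exprn_gt0//.
    exact: truncnS_gt.
  exists (y N); exists N => // n /= Nn.
  rewrite -ball_normE /= -(@ltr_pXn2r _ 2)// ?nnegrE ?(ltW e0)//.
  apply: le_lt_trans (dist _ _) _; apply: le_lt_trans NP.
  have : (n.+1%:R^-1 : R) <= N.+1%:R^-1 by rewrite lef_pV2 ?posrE// ler_nat.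
  by move: (n.+1%:R^-1 : R) (N.+1%:R^-1 : R) => en eN; lra.
move=> /cvg_ex[/= xb yxb]; exists xb => h.
suff -> : ip xb h = ell h by [].
(* First-order optimality of [xb] in the direction [h], obtained by perturbing the almost minimizers
   [y k]. *)
have key t : 2 * t * (ell h - ip xb h) <= t ^+ 2 * ip h h.
  have c1 : (fun k => 2 * t * (ell h - ip (y k) h)) @ \oo
      --> 2 * t * (ell h - ip xb h).
    exact: (cvgMl_tmp (a := 2 * t) (cvgB (cvg_cst (ell h)) (cvg_ipr (h := h) _ yxb))).
  have c2 : (fun k : nat => k.+1%:R^-1 + t ^+ 2 * ip h h) @ \oo
      --> t ^+ 2 * ip h h.
    rewrite -[X in _ --> X]add0r.
    exact: (cvgD (@cvg_harmonic R) (cvg_cst (t ^+ 2 * ip h h))).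
  apply: (ler_cvg_to c1 c2).
  apply: nearW => k; have := Ile (y k + t *: h).
    by have := yP k; rewrite /Phi !ellD ellZ !ipE (ipC h (y k)); move: (k.+1%:R^-1 : R) => ek; lra.
have h0 := ip_ge0 ipP h.
set u := ell h - ip xb h in key.
(* The best t would be u / |h|^2; the added 1 keeps the denominator positive when h = 0. *)
have := key (u / (ip h h + 1)).
rewrite -subr_ge0.
set q := ip h h + 1.
have q0 : 0 < q by rewrite /q; lra.
have -> : (u / q) ^+ 2 * ip h h - 2 * (u / q) * u = - (u ^+ 2 * (q + 1) / q ^+ 2).
  by rewrite /q; field; rewrite gt_eqF.
rewrite oppr_ge0 => hle.
have : u ^+ 2 <= 0.
  move: hle; rewrite pmulr_lle0 ?invr_gt0 ?exprn_gt0// pmulr_lle0//; lra.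
rewrite le_eqVlt ltNge sqr_ge0 orbF sqrf_eq0 => /eqP.
by rewrite /u; lra.
Qed.

End UltraLimits.

Section WeakClosure.
Context {R : realType} {H : completeNormedModType R} {ip : H -> H -> R}.
Hypothesis ipP : inner_product ip.
Let ipC := ipC ipP.
Let ipE := ipE ipP.

Lemma maximally_monotone_mem (A : H -> set H) x u :
  maximally_monotone ip A ->
  (forall y v, A y v -> 0 <= ip (x - y) (u - v)) -> A x u.
Proof.
move=> [mA maxA] h.
pose A' y := [set v | A y v \/ y = x /\ v = u].
have <- : A' = A; last by right.
apply: maxA; last by move=> y v; left.
move=> y1 y2 v1 v2 [A1|[-> ->]] [A2|[-> ->]].
- exact: mA.
- by rewrite -(opprB x) -(opprB u) (ipNl ipP) (ipNr ipP) opprK; exact: h.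
- exact: h.
- by rewrite !subrr (ip0l ipP).
Qed.

(* Hemicontinuity: Minty's trick for an everywhere defined Lipschitz operator. *)
Lemma lipschitz_monotone_mem (B : H -> H) mu x v :
  0 < mu -> lipschitz_op mu B ->
  (forall y, 0 <= ip (x - y) (v - B y)) -> v = B x.
Proof.
move=> mu0 lipB h; apply/eqP; rewrite -subr_eq0; apply/eqP/(ip_eq0 ipP).
(* With this [t] the Lipschitz error mu t |c|^2 is half of |c|^2, so |c|^2 <= |c|^2 / 2. *)
set c := v - B x; set t := (2 * mu)^-1.
have t0 : 0 < t by rewrite invr_gt0 mulr_gt0.
have := h (x + t *: c).
have -> : x - (x + t *: c) = - (t *: c) by rewrite opprD addrA subrr add0r.
have -> : v - B (x + t *: c) = c - (B (x + t *: c) - B x).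
  by rewrite /c opprB addrA subrK.
rewrite (ipNl ipP) (ipZl ipP) oppr_ge0 pmulr_rle0// (ipDr ipP) (ipNr ipP) subr_le0.
have hle : ip c (B (x + t *: c) - B x) <= 2^-1 * ip c c.
  apply: le_trans (ip_le_norm ipP _ _) _.
  apply: le_trans (ler_wpM2l _ (lipB _ _)) _ => //.
  rewrite addrAC subrr add0r normrZ gtr0_norm// -(ip_sqr ipP) /t.
  by rewrite le_eqVlt; apply/orP; left; apply/eqP; field; rewrite gt_eqF.
have := ip_ge0 ipP c; lra.
Qed.

(* Maximality of A + B (Minty's theorem) is avoided by comparing
   lim <x_n, p_n> >= <z, -v> and lim <x_n, B x_n> >= <z, v>, whose sum is 0. *)
Lemma weak_cluster_zer (A : H -> set H) (B : H -> H) (mu M : R) (U : set_system nat)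
    (x p : nat -> H) :
  maximally_monotone ip A -> monotone_op ip B -> 0 < mu -> lipschitz_op mu B ->
  UltraFilter U -> (forall n, `|x n| <= M) -> (forall n, A (x n) (p n)) ->
  (fun n => p n + B (x n)) @ U --> 0 ->
  exists2 z, zer A B z & forall h, ip (x n) h @[n --> U] --> ip z h.
Proof.
move=> maxA mB mu0 lipB UU xM Axp pB0.
have [z xz] := ultra_weak_limit ipP UU xM.
have BM n : `|B (x n)| <= mu * M + `|B 0|.
  rewrite -lerBlDr; apply: le_trans (lerB_dist _ _) _.
  by apply: le_trans (lipB _ _) _; rewrite subr0 ler_pM2l.
have [v Bv] := ultra_weak_limit ipP UU BM.
have M0 : 0 <= M by apply: le_trans (xM 0%N).
have [s' s'P] : exists s : R, ip (x n) (B (x n)) @[n --> U] --> s.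
  apply: (@ultra_bounded_cvg R _ _ U (M * (mu * M + `|B 0|))) => n.
  by apply: le_trans (ip_cauchy_schwarz ipP _ _) _; rewrite ler_pM.
have pBh h : ip (p n + B (x n)) h @[n --> U] --> (0 : R).
  by rewrite -(ip0l ipP h); exact: cvg_ipr.
have xp : ip (x n) (p n) @[n --> U] --> - s'.
  have c0 : ip (p n + B (x n)) (x n) @[n --> U] --> (0 : R).
    apply: norm_cvg0.
    have c1 : M * `|p n + B (x n)| @[n --> U] --> (0 : R).
      by rewrite -(mulr0 M) -(@normr0 _ H); exact: (cvgMl_tmp (a := M) (cvg_norm pB0)).
    apply: (squeeze_cvgr _ (cvg_cst 0) c1); apply: nearW => n.
    by rewrite normr_ge0/= mulrC (le_trans (ip_cauchy_schwarz ipP _ _))// ler_wpM2l.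
  have -> : (fun n => ip (x n) (p n)) =
      (fun n => ip (p n + B (x n)) (x n) - ip (x n) (B (x n))).
    by apply/funext => n; rewrite (ipDl ipP) (ipC (p n)) (ipC (B _)) addrK.
  by rewrite -[X in _ --> X]add0r; exact: (cvgB c0 s'P).
have ph h : ip (p n) h @[n --> U] --> - ip v h.
  have -> : (fun n => ip (p n) h) = (fun n => ip (p n + B (x n)) h - ip (B (x n)) h).
    by apply/funext => n; rewrite (ipDl ipP) addrK.
  by rewrite -[X in _ --> X]add0r; exact: (cvgB (pBh h) (Bv h)).
have hA q a : A q a -> 0 <= - s' - ip z a + ip v q + ip q a.
  move=> Aqa.
  have c1 : ip (x n) (p n) - ip (x n) a - ip (p n) q + ip q a @[n --> U] -->
      - s' - ip z a - (- ip v q) + ip q a.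
    exact: (cvgD (cvgB (cvgB xp (xz a)) (ph q)) (cvg_cst (ip q a))).
  rewrite opprK in c1; apply: (cvgr_to_ge c1); apply: nearW => n.
  have := maxA.1 _ _ _ _ (Axp n) Aqa.
  by rewrite !ipE (ipC q (p n)); lra.
have hB q : 0 <= s' - ip z (B q) - ip v q + ip q (B q).
  have c1 : ip (x n) (B (x n)) - ip (x n) (B q) - ip (B (x n)) q + ip q (B q) @[n --> U] -->
      s' - ip z (B q) - ip v q + ip q (B q).
    exact: (cvgD (cvgB (cvgB s'P (xz (B q))) (Bv q)) (cvg_cst (ip q (B q)))).
  apply: (cvgr_to_ge c1); apply: nearW => n.
  by have := mB (x n) q; rewrite !ipE (ipC q (B (x n))); lra.
(* The order matters. [hB z] says s' >= <z, v>, which turns [hA] into the condition for -v to lie in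
   [A z]. Then [hA] at (z, -v) gives s' <= <z, v>, and equality turns [hB] into Minty's condition
   for v = B z. *)
have hBz := hB z.
have Az : A z (- v).
  apply: (maximally_monotone_mem maxA) => q a /hA.
  by rewrite !ipE (ipC q v) (ipC z v); move: hBz; rewrite (ipC v z); lra.
have hAz := hA _ _ Az.
have vB : v = B z.
  apply: (lipschitz_monotone_mem mu0 lipB) => q; have := hB q.
  by move: hAz hBz; rewrite !ipE (ipC q v) (ipC z v); lra.
by exists z => //; exists (- v); rewrite // vB addNr.
Qed.

Lemma opial_zer (A : H -> set H) (B : H -> H) (mu M : R) (D : set H)
    (x p : nat -> H) :
  maximally_monotone ip A -> monotone_op ip B -> 0 < mu -> lipschitz_op mu B ->
  (forall z e, zer A B z -> 0 < e -> exists2 d, D d & `|z - d| < e) ->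
  (forall d, D d -> cvg (`|x n - d| ^+ 2 @[n --> \oo])) ->
  (forall n, `|x n| <= M) -> (forall n, A (x n) (p n)) ->
  (fun n => p n + B (x n)) @ \oo --> 0 ->
  exists2 z, zer A B z & weak_cvg ip x z.
Proof.
move=> maxA mB mu0 lipB Dd cvgD xM Axp pB0.
have M0 : 0 <= M by apply: le_trans (xM 0%N).
have cluster U : UltraFilter U -> \oo `<=` U ->
    exists2 z, zer A B z & forall h, ip (x n) h @[n --> U] --> ip z h.
  move=> UU sU; apply: (weak_cluster_zer maxA mB mu0 lipB UU xM Axp).
  by apply: cvg_trans pB0; exact: cvg_fmap2.
have uniq U V z w : UltraFilter U -> \oo `<=` U -> UltraFilter V -> \oo `<=` V ->
    zer A B z -> zer A B w ->
    (forall h, ip (x n) h @[n --> U] --> ip z h) ->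
    (forall h, ip (x n) h @[n --> V] --> ip w h) -> z = w.
  move=> UU sU VV sV Zz Zw xz xw.
  (* along D the difference of squared distances is affine in <x_n, .> *)
  have key d d' : D d -> D d' -> ip (z - w) (d - d') = 0.
    move=> /cvgD/cvg_ex[/= l ld] /cvgD/cvg_ex[/= l' ld'].
    have e : (fun n => ip (x n) (d - d')) = (fun n => 2^-1 * (`|x n - d'| ^+ 2 - `|x n - d| ^+ 2
       - (ip d' d' - ip d d))).
      by apply/funext => n; rewrite !(ip_sqr ipP) !ipE (ipC d' (x n)) (ipC d (x n)); lra.
    have c : ip (x n) (d - d') @[n --> \oo] --> 2^-1 * (l' - l - (ip d' d' - ip d d)).
      by rewrite e; exact: (cvgMl_tmp (a := 2^-1) (cvgB (cvgB ld' ld) (cvg_cst (ip d' d' - ip d d)))).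
    have cU : ip (x n) (d - d') @[n --> U] --> 2^-1 * (l' - l - (ip d' d' - ip d d)).
      by apply: cvg_trans c; exact: cvg_fmap2.
    have cV : ip (x n) (d - d') @[n --> V] --> 2^-1 * (l' - l - (ip d' d' - ip d d)).
      by apply: cvg_trans c; exact: cvg_fmap2.
    rewrite (ipDl ipP) (ipNl ipP).
    rewrite (cvg_unique _ (xz (d - d')) cU) ?(cvg_unique _ (xw (d - d')) cV)//.
    by rewrite subrr.
  apply/eqP; rewrite -subr_eq0; apply/eqP; apply: contrapT => /eqP zw.
  have zw0 : 0 < `|z - w| by rewrite normr_gt0.
  have e0 : 0 < `|z - w| / 4 by lra.
  have [d Dd1 zd] := Dd z _ Zz e0.
  have [d' Dd2 wd] := Dd w _ Zw e0.
  have : ip (z - w) (z - w) = ip (z - w) ((z - d) - (w - d')).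
    have -> : (z - d) - (w - d') = (z - w) - (d - d').
      by rewrite !opprB (addrC d' (- w)) addrACA (addrC (- d)).
    by rewrite [RHS](ipDr ipP) (ipNr ipP) key// subr0.
  move=> h.
  have := ip_le_norm ipP (z - w) ((z - d) - (w - d')); rewrite -h -(ip_sqr ipP) expr2.
  rewrite ler_pM2l// => /le_trans/(_ (ler_normB _ _)); lra.
have [U0 [UU0 sU0]] := @ultraFilterLemma nat \oo _.
have [z Zz xz] := cluster U0 UU0 sU0.
exists z => // h; apply: cvg_ultraP => V VV sV.
have [w Zw xw] := cluster V VV sV.
by rewrite (uniq U0 V z w).
Qed.

End WeakClosure.

(** * Measurability in separable Hilbert spaces *)

Section SeparableMeasurability.
Context {R : realType} {H : normedModType R}.

Lemma separable_seq : @separable R H ->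
  exists s : nat -> H, forall x e, 0 < e -> exists n, `|x - s n| < e.
Proof.
move=> [D [/countable_injP[f finj] Dd]].
pose s n := xget 0 [set d | D d /\ f d = n].
exists s => x e e0.
have : closure D x by rewrite Dd.
move=> /(_ _ (nbhsx_ballx x e e0))[d [Dd' /= xd]].
exists (f d); have [] : D (s (f d)) /\ f (s (f d)) = f d.
  exact: (@xgetI _ 0 [set d' | D d' /\ f d' = f d] d).
move=> Ds fs; suff -> : s (f d) = d by move: xd; rewrite -ball_normE.
by apply: finj; rewrite ?inE.
Qed.

Context (s : nat -> H).
Hypothesis sP : forall x e, 0 < e -> exists n, `|x - s n| < e.
Context {d} {T : measurableType d}.
Implicit Types X Y : T -> H.

Let rad (k : nat) : R := k.+1%:R^-1.

Let rad_gt0 k : 0 < rad k. Proof. by rewrite invr_gt0. Qed.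

Let rad_lt e : 0 < e -> exists k, 2 * rad k < e.
Proof.
move=> e0; exists (Num.trunc (2 / e)).
by rewrite /rad ltr_pdivrMr// mulrC -ltr_pdivrMr//; exact: truncnS_gt.
Qed.

Lemma measurable_fun_open_preimage (f : T -> R) :
  (forall U, open U -> measurable (f @^-1` U)) -> measurable_fun setT f.
Proof.
move=> h; apply: (measurability _ (RGenOpens.measurableE R)).
by move=> _ [_ [a [b ->] <-]]; rewrite setTI; apply: h; exact: interval_open.
Qed.

Lemma H_rv_comp {K : topologicalType} (F : H -> K) X U :
  H_rv X -> continuous F -> open U -> measurable ((F \o X) @^-1` U).
Proof. by move=> mX /continuousP/(_ U) cF oU; apply: (mX (F @^-1` U)); exact: cF. Qed.

Lemma H_rv_comp2 {K : topologicalType} (F : H * H -> K) X Y U :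
  H_rv X -> H_rv Y -> continuous F -> open U ->
  measurable ((fun w => F (X w, Y w)) @^-1` U).
Proof.
move=> mX mY cF oU.
pose box i j k : set T :=
  if `[< ball (s i) (rad k) `*` ball (s j) (rad k) `<=` F @^-1` U >] then
    X @^-1` ball (s i) (rad k) `&` Y @^-1` ball (s j) (rad k) else set0.
have -> : (fun w => F (X w, Y w)) @^-1` U = \bigcup_i \bigcup_j \bigcup_k box i j k.
  apply/seteqP; split=> w /=; last first.
    move=> [i _ [j _ [k _]]]; rewrite /box; case: asboolP => // sub [Xi Yj].
    exact: (sub (X w, Y w)).
  move=> Uw; have : nbhs (X w, Y w) (F @^-1` U).
    by apply: open_nbhs_nbhs; split=> //; move/continuousP : cF; apply.
  move=> /nbhs_ballP[e /= e0 be]; have [k ke] := rad_lt e0.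
  have [i Xi] := sP (X w) (rad_gt0 k); have [j Yj] := sP (Y w) (rad_gt0 k).
  exists i => //; exists j => //; exists k => //; rewrite /box.
  have near_ball (a b c : H) : `|a - b| < rad k -> `|b - c| < rad k -> ball a e c.
    move=> ab bc; rewrite -ball_normE /=; apply: lt_trans ke.
    rewrite -(subrK b a) -addrA; apply: le_lt_trans (ler_normD _ _) _.
    by lra.
  case: asboolP => [sub|nsub].
    by split; rewrite -ball_normE /= distrC.
  exfalso; apply: nsub => -[a b] [/=]; rewrite -!ball_normE /= => ia jb.
  by apply: be; split; [exact: near_ball ia|exact: near_ball jb].
apply: bigcupT_measurable => i; apply: bigcupT_measurable => j.
apply: bigcupT_measurable => k; rewrite /box; case: ifP => // _.
by apply: measurableI; [apply: mX|apply: mY]; exact: ball_open.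
Qed.

Lemma H_rvD X Y : H_rv X -> H_rv Y -> H_rv (fun w => X w + Y w).
Proof.
by move=> mX mY U oU; apply: (@H_rv_comp2 H (fun p => p.1 + p.2)) => //; exact: add_continuous.
Qed.

Lemma H_rvZ (a : R) X : H_rv X -> H_rv (fun w => a *: X w).
Proof. by move=> mX U oU; apply: (H_rv_comp (F := *:%R a)) => //; exact: scaler_continuous. Qed.

Lemma H_rv_cst (c : H) : H_rv (fun _ : T => c).
Proof.
move=> U oU; have [Uc|nUc] := pselect (U c).
  by rewrite (_ : _ @^-1` _ = setT)//; apply/seteqP; split.
by rewrite (_ : _ @^-1` _ = set0)//; apply/seteqP; split.
Qed.

Lemma H_rvB X Y : H_rv X -> H_rv Y -> H_rv (fun w => X w - Y w).
Proof.
move=> mX mY; apply: H_rvD => //.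
have -> : (fun w => - Y w) = (fun w => (-1) *: Y w) by apply/funext => w; rewrite scaleN1r.
exact: H_rvZ.
Qed.

Lemma measurable_H_norm X : H_rv X -> measurable_fun setT (fun w => `|X w|).
Proof.
move=> mX; apply: measurable_fun_open_preimage => U oU.
exact: (@H_rv_comp R^o (fun v : H => `|v|) X U mX (@norm_continuous _ _) oU).
Qed.

Lemma measurable_ip (ip : H -> H -> R) X Y : inner_product ip -> H_rv X -> H_rv Y ->
  measurable_fun setT (fun w => ip (X w) (Y w)).
Proof.
move=> ipP mX mY.
have -> : (fun w => ip (X w) (Y w)) =
    (fun w => 2^-1 * (`|X w + Y w| ^+ 2 - `|X w| ^+ 2 - `|Y w| ^+ 2)).
  apply/funext => w; rewrite !(ip_sqr ipP) !(ipE ipP) (ipC ipP (Y w) (X w)).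
  by field.
apply: measurable_funM => //; apply: measurable_funB.
  apply: measurable_funB; apply: measurable_funX; apply: measurable_H_norm => //.
  exact: H_rvD.
by apply: measurable_funX; apply: measurable_H_norm.
Qed.

Lemma H_rv_resolvent (ip : H -> H -> R) (A : H -> set H) (gamma : R) X Y :
  inner_product ip -> set_monotone ip A -> 0 < gamma ->
  H_rv X -> (forall w, resolvent gamma A (X w) (Y w)) -> H_rv Y.
Proof.
move=> ipP mA g0 mX res U oU.
have nonexp z z' p p' : resolvent gamma A z p -> resolvent gamma A z' p' ->
    `|p - p'| <= `|z - z'|.
  move=> [a Aa ->] [a' Aa' ->].
  have := mA _ _ _ _ Aa Aa'; set q := p - p'; set b := a - a' => qb.
  have -> : p + gamma *: a - (p' + gamma *: a') = q + gamma *: b.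
    by rewrite /q /b scalerBr opprD addrACA.
  have [->|q0] := eqVneq q 0; first by rewrite normr0.
  have q1 : 0 < `|q| by rewrite normr_gt0.
  rewrite -(ler_pM2l q1) -expr2 (ip_sqr ipP).
  apply: le_trans (ip_le_norm ipP _ _).
  by rewrite (ipDr ipP) (ipZr ipP) lerDl mulr_ge0// ltW.
(* the resolvent is 1-Lipschitz on its domain, so the preimage of U is the trace of an open set *)
pose O := \bigcup_(t in [set t : H * H * R | [/\ resolvent gamma A t.1.1 t.1.2, 0 < t.2
                         & ball t.1.2 t.2 `<=` U]]) ball t.1.1 t.2.
have -> : Y @^-1` U = X @^-1` O.
  apply/seteqP; split=> w /=.
    move=> UY; have /nbhs_ballP[e /= e0 be] : nbhs (Y w) U by exact: open_nbhs_nbhs.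
    by exists (X w, Y w, e); [split => /=|exact: ballxx].
  move=> [[[z p] e] /= [rzp e0 be]]; rewrite -ball_normE /= => zX.
  by apply: be; rewrite -ball_normE /=; apply: le_lt_trans zX; exact: nonexp (res w).
by apply: mX; apply: bigcup_open => -[[z p] e] [/= _ e0 _]; exact: ball_open.
Qed.

Lemma H_rv_closed_balls X :
  (forall c rho, measurable [set w | `|X w - c| <= rho]) -> H_rv X.
Proof.
move=> mX U oU.
pose F i k : set T := if `[< [set y | `|y - s i| <= rad k] `<=` U >] then
   [set w | `|X w - s i| <= rad k] else set0.
have -> : X @^-1` U = \bigcup_i \bigcup_k F i k.
  apply/seteqP; split=> w /=; last first.
    by move=> [i _ [k _]]; rewrite /F; case: asboolP => // sub /sub.
  move=> UX; have /nbhs_ballP[e /= e0 be] : nbhs (X w) U by exact: open_nbhs_nbhs.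
  have [k ke] := rad_lt e0; have [i Xi] := sP (X w) (rad_gt0 k).
  exists i => //; exists k => //; rewrite /F; case: asboolP => [_|nsub] /=; first exact: ltW.
  exfalso; apply: nsub => y /= yi; apply: be; rewrite -ball_normE /=.
  apply: lt_trans ke; rewrite -(subrK (s i) (X w)) -addrA.
  apply: le_lt_trans (ler_normD _ _) _; rewrite (distrC (s i)); lra.
apply: bigcupT_measurable => i; apply: bigcupT_measurable => k.
by rewrite /F; case: ifP.
Qed.

Lemma norm_le_ip (ip : H -> H -> R) (v : H) (rho : R) : inner_product ip ->
  0 <= rho -> (`|v| <= rho <-> forall i, ip v (s i) <= rho * `|s i|).
Proof.
move=> ipP rho0; split=> [vr i|h].
  by apply: le_trans (ip_le_norm ipP _ _) _; rewrite ler_wpM2r.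
have [->|v0] := eqVneq v 0; first by rewrite normr0.
have v1 : 0 < `|v| by rewrite normr_gt0.
apply/ler_addgt0Pr => e e0.
pose dl := e * `|v| / (rho + `|v|).
have rv : 0 < rho + `|v| by lra.
have dl0 : 0 < dl by rewrite divr_gt0// mulr_gt0.
have [i vi] := sP v dl0.
have : `|v| ^+ 2 <= `|v| * dl + rho * (dl + `|v|).
  have -> : `|v| ^+ 2 = ip v (v - s i) + ip v (s i).
    by rewrite -(ipDr ipP) subrK (ip_sqr ipP).
  apply: lerD.
    by apply: le_trans (ip_le_norm ipP _ _) _; rewrite ler_wpM2l// ltW.
  apply: le_trans (h i) _; rewrite ler_wpM2l//.
  have -> : s i = (s i - v) + v by rewrite subrK.
  by apply: le_trans (ler_normD _ _) _; rewrite lerD2r distrC ltW.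
have -> : `|v| * dl + rho * (dl + `|v|) = `|v| * (rho + e).
  by rewrite /dl; field; rewrite gt_eqF.
by rewrite expr2 ler_pM2l.
Qed.

Lemma H_rv_weak_limit (ip : H -> H -> R) (x : nat -> T -> H) (xb : T -> H) (E : set T) z0 :
  inner_product ip -> measurable E -> (forall n, H_rv (x n)) ->
  (forall w, E w -> weak_cvg ip (x ^~ w) (xb w)) -> (forall w, ~ E w -> xb w = z0) ->
  H_rv xb.
Proof.
move=> ipP mE mx xE xnE; apply: H_rv_closed_balls => c rho.
have [rho0|rho0] := ltP rho 0.
  rewrite (_ : [set _ | _] = set0)//; apply/seteqP; split=> w //=.
  by rewrite leNgt (lt_le_trans rho0).
have -> : [set w | `|xb w - c| <= rho] =
    (~` E `&` [set w | `|z0 - c| <= rho]) `|`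
    \bigcap_i (E `&` [set w | ip (xb w - c) (s i) <= rho * `|s i|]).
  apply/seteqP; split=> w /=.
    have [Ew|nEw] := pselect (E w); last by rewrite xnE//; left.
    by move=> /(norm_le_ip _ ipP rho0) h; right=> i _; split => //=.
  move=> [[nEw]|h]; first by rewrite xnE.
  by apply/(norm_le_ip _ ipP rho0) => i; have [] := h i I.
apply: measurableU.
  apply: measurableI; first exact: measurableC.
  have [h|h] := boolP (`|z0 - c| <= rho).
    by rewrite (_ : [set _ | _] = setT)//; apply/seteqP; split.
  by rewrite (_ : [set _ | _] = set0)//; apply/seteqP; split=> w //=; rewrite (negbTE h).
apply: bigcapT_measurable => i.
have mip : measurable_fun E (fun w => ip (xb w - c) (s i)).
  apply: (@measurable_fun_cvg _ _ _ E (fun n w => ip (x n w - c) (s i))).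
    move=> n; apply: (@measurable_funS _ _ _ _ setT) => //.
    apply: measurable_ip => //; last exact: H_rv_cst.
    by apply: H_rvB => //; exact: H_rv_cst.
  move=> w /xE/(_ (s i)) h.
  have -> : (fun n => ip (x n w - c) (s i)) = (fun n => ip (x n w) (s i) - ip c (s i)).
    by apply/funext => n; rewrite (ipDl ipP) (ipNl ipP).
  by rewrite (ipDl ipP) (ipNl ipP); exact: (cvgB h (cvg_cst (ip c (s i)))).
have := mip mE `]-oo, (rho * `|s i|)]%classic (measurable_itv _).
by congr measurable; apply/seteqP; split=> w /= []; rewrite in_itv.
Qed.

End SeparableMeasurability.

(** * Almost supermartingales *)

Section ConditionalInequality.
Context {d} {T : measurableType d} {R : realType}.
Local Open Scope ereal_scope.

Lemma le_integral_mean0 (mu : {measure set T -> \bar R}) (D : set T) (f g h : T -> R) :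
  measurable D -> measurable_fun setT f -> measurable_fun setT g ->
  (forall w, (0 <= f w)%R) -> (forall w, (0 <= g w)%R) ->
  mu.-integrable D (EFin \o h) -> \int[mu]_(w in D) (h w)%:E = 0 ->
  (forall w, D w -> (f w + h w <= g w)%R) ->
  \int[mu]_(w in D) (f w)%:E <= \int[mu]_(w in D) (g w)%:E.
Proof.
move=> mD mf mg f0 g0 ih h0 fg.
have mfD : measurable_fun D (EFin \o f) by apply/measurable_EFinP; exact: measurable_funTS.
have mgD : measurable_fun D (EFin \o g) by apply/measurable_EFinP; exact: measurable_funTS.
have [->|goo] := eqVneq (\int[mu]_(w in D) (g w)%:E) +oo; first exact: leey.
have ig : mu.-integrable D (EFin \o g).
  apply/integrableP; split => //.
  have -> : (fun x => `|(EFin \o g) x|) = (EFin \o g).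
    by apply/funext => w /=; rewrite ger0_norm.
  by rewrite ltey.
have -> : \int[mu]_(w in D) (g w)%:E =
    \int[mu]_(w in D) (((EFin \o g) \- (EFin \o h)) w).
  by rewrite integralB// h0 sube0.
apply: ge0_le_integral => //.
- by move=> w _; rewrite lee_fin.
- by apply: emeasurable_funB => //; have /integrableP[] := ih.
- by move=> w Dw /=; rewrite -EFinB lee_fin lerBrDr fg.
Qed.

Context {H : normedModType R} {ip : H -> H -> R} {s : nat -> H}.
Hypothesis ipP : inner_product ip.
Hypothesis sP : forall (x : H) (e : R), (0 < e)%R -> exists n, (`|x - s n| < e)%R.

(* Being conditionally centred, X - Y drops out when tested against a
   G-measurable z; z is approximated by countably-valued maps, so that <X - Y, z> need not be integrable. *)
Lemma condexp_H_le_integral (P : probability T R) (gens : set (set T))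
    (X Y z : T -> H) (f g : T -> R) (S : set T) :
  <<s gens>> `<=` @measurable d T ->
  condexp_H ip P <<s gens>> X Y -> borel_meas_wrt <<s gens>> z ->
  measurable_fun setT f -> measurable_fun setT g ->
  (forall w, (0 <= f w)%R) -> (forall w, (0 <= g w)%R) ->
  (forall w, (f w + 2 * ip (X w - Y w) (z w) <= g w)%R) ->
  <<s gens>> S ->
  \int[P]_(w in S) (f w)%:E <= \int[P]_(w in S) (g w)%:E.
Proof.
move=> sub [mX iX mY0 iY cXY] mz mf mg f0 g0 fg GS.
have mY : H_rv Y by move=> U oU; apply: sub; exact: mY0.
have mS : measurable S by exact: sub.
pose e w := (X w - Y w)%R.
have me : H_rv e by exact: (H_rvB sP).
have mne : measurable_fun setT (fun w => `|e w|%R) by exact: measurable_H_norm.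
have ie : P.-integrable setT (EFin \o (fun w => `|e w|%R)).
  apply: (@le_integrable _ _ _ _ _ _ _ (fun w => (`|X w|%R)%:E + (`|Y w|%R)%:E)) => //.
  - exact/measurable_EFinP.
  - by move=> w _ /=; rewrite lee_fin !ger0_norm ?addr_ge0//; exact: ler_normB.
  - exact: integrableD.
have e_fin : \int[P]_(w in S) (`|e w|%R)%:E \is a fin_num.
  by apply: integrable_fin_num => //; exact: (integrableS measurableT mS _ ie).
have iip (Z : T -> H) h A : measurable A -> H_rv Z ->
    P.-integrable setT (fun w => (`|Z w|%R)%:E) ->
    P.-integrable A (fun w => (ip (Z w) h)%:E).
  move=> mA mZ iZ; apply: (@integrableS _ _ _ _ setT) => //.
  apply: (@le_integrable _ _ _ _ _ _ _ (fun w => (`|h|%R)%:E * (`|Z w|%R)%:E)) => //.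
  - by apply/measurable_EFinP; apply: (measurable_ip sP ipP mZ); exact: H_rv_cst.
  - move=> w _ /=; rewrite lee_fin mulrC.
    by rewrite (ger0_norm (mulr_ge0 _ _))// (ip_cauchy_schwarz ipP).
  - exact: integrableZl.
have mean0 h A : <<s gens>> A -> \int[P]_(w in A) (2 * ip (e w) h)%:E = 0.
  move=> GA; have mA : measurable A by exact: sub.
  have -> : (fun w => (2 * ip (e w) h)%:E) =
    (fun w => 2%:E * ((ip (X w) h)%:E - (ip (Y w) h)%:E)).
    by apply/funext => w; rewrite /e (ipDl ipP) (ipNl ipP) -EFinB -EFinM.
  rewrite integralZl//; last by apply: integrableB => //; exact: iip.
  rewrite integralB//; [|exact: iip..].
  by rewrite cXY// subee ?mule0//; apply: integrable_fin_num => //; exact: iip.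
apply/lee_addgt0Pr => /= eps eps0.
pose K := (\int[P]_(w in S) (`|e w|%R)%:E).
pose dl := (eps / (2 * (fine K + 1)))%R.
have K0 : (0 <= fine K)%R by apply: fine_ge0; apply: integral_ge0 => w _; rewrite lee_fin.
have dl0 : (0 < dl)%R by rewrite divr_gt0// mulr_gt0//; lra.
pose C i : set (g_sigma_algebraType gens) := z @^-1` ball (s i) dl.
have mC i : measurable (C i) by apply: mz; exact: ball_open.
pose E i := S `&` seqDU C i.
have GE i : <<s gens>> (E i).
  exact: (@measurableI _ (g_sigma_algebraType gens) S (seqDU C i) GS (seqDU_measurable mC i)).
have mE i : measurable (E i) by exact: sub.
have SE : S = \bigcup_i E i.
  rewrite /E -setI_bigcupr -seqDU_bigcup_eq setIidl// => w _.
  by have [i zi] := sP (z w) dl0; exists i => //; rewrite /C /= -ball_normE /= distrC.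
have tE : trivIset setT E by apply: trivIset_setIl; exact: trivIset_seqDU.
pose g' w := (g w + (2 * dl) * `|e w|)%R.
have mg' : measurable_fun setT g'.
  by apply: measurable_funD => //; apply: measurable_funM.
have g'0 w : (0 <= g' w)%R by rewrite addr_ge0// mulr_ge0// mulr_ge0// ltW.
apply: (@le_trans _ _ (\int[P]_(w in S) (g' w)%:E)).
  rewrite [in X in X <= _]SE [in X in _ <= X]SE !ge0_integral_bigcup//; last 4 first.
  - by rewrite -SE; apply/measurable_EFinP; exact: measurable_funTS.
  - by move=> w _; rewrite lee_fin.
  - by rewrite -SE; apply/measurable_EFinP; exact: measurable_funTS.
  - by move=> w _; rewrite lee_fin.
  apply: lee_nneseries => [i _ _|i _].
    by apply: integral_ge0 => w _; rewrite lee_fin.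
  apply: (@le_integral_mean0 _ _ _ _ (fun w => 2 * ip (e w) (s i))%R) => //.
  - apply: (eq_integrable _ (fun w => 2%:E * (ip (e w) (s i))%:E)) => //.
    by apply: integrableZl => //; exact: iip.
  - exact: mean0.
  - move=> w [_ Cw]; have := @subset_seqDU _ C i w Cw; rewrite /C /= -ball_normE /= => zi.
    have := fg w; rewrite -/(e w).
    have -> : ip (e w) (z w) = (ip (e w) (s i) + ip (e w) (z w - s i))%R.
      by rewrite (ipDr ipP) (ipNr ipP) addrCA subrr addr0.
    have : (- ip (e w) (z w - s i) <= `|e w| * dl)%R.
      rewrite -(ipNl ipP); apply: le_trans (ip_le_norm ipP _ _) _.
      by rewrite normrN ler_wpM2l// distrC ltW.
    rewrite /g'; lra.
have -> : \int[P]_(w in S) (g' w)%:E = \int[P]_(w in S) (g w)%:E + (2 * dl)%:E * K.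
  have -> : (fun w => (g' w)%:E) = (fun w => (g w)%:E + (2 * dl)%:E * (`|e w|%R)%:E).
    by apply/funext => w; rewrite /g' EFinD EFinM.
  rewrite ge0_integralD//; last 4 first.
  - by move=> w _; rewrite lee_fin.
  - by apply/measurable_EFinP; exact: measurable_funTS.
  - by move=> w _; rewrite -EFinM lee_fin mulr_ge0// mulr_ge0// ltW.
  - apply/measurable_EFinP; apply: measurable_funTS.
    exact: measurable_funM.
  rewrite ge0_integralZl_EFin//; first by apply/measurable_EFinP; exact: measurable_funTS.
  by rewrite mulr_ge0// ltW.
apply: leeD2l; have -> : K = (fine K)%:E by rewrite fineK.
rewrite -EFinM lee_fin /dl.
have -> : (2 * (eps / (2 * (fine K + 1))) * fine K = eps * (fine K / (fine K + 1)))%R.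
  by field; rewrite gt_eqF//; lra.
by rewrite ler_piMr ?(ltW eps0)// ler_pdivrMr; lra.
Qed.

End ConditionalInequality.

Section AlmostSupermartingales.
Context {R : realType}.

Lemma cvg_no_upcrossing (u : nat -> R) (M : R) :
  (forall n, 0 <= u n) -> ~ (\forall n \near \oo, M <= u n) ->
  (forall a b : rat, a < b ->
     (\forall n \near \oo, u n < ratr b) \/ (\forall n \near \oo, ratr a < u n)) ->
  cvg (u @ \oo).
Proof.
move=> u0 uM cross.
have crossR (a b : R) : a < b ->
    (\forall n \near \oo, u n < b) \/ (\forall n \near \oo, a < u n).
  move=> ab.
  have [q /[!in_itv]/= /andP[aq qb]] := rat_in_itvoo ab.
  have [r /[!in_itv]/= /andP[qr rb]] := rat_in_itvoo qb.
  have qr' : q < r by rewrite ltr_rat in qr.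
  have [h|h] := cross q r qr'.
  - by left; apply: filterS h => n h; exact: lt_trans rb.
  - by right; apply: filterS h => n h; exact: lt_trans h.
pose E := [set a : R | \forall n \near \oo, a < u n].
have supE : has_sup E.
  split.
    by exists (-1); apply: nearW => n; apply: lt_le_trans (u0 n); rewrite ltrN10.
  exists M => a Ea; rewrite leNgt; apply/negP => Ma; apply: uM.
  by apply: filterS Ea => n an; rewrite ltW// (lt_trans Ma).
apply/cvg_ex; exists (sup E); apply/cvgrPdist_lt => e e0.
have e2 : 0 < e / 2 by rewrite divr_gt0.
have [a Ea ae] := sup_adherent e2 supE.
have ee : sup E + e / 2 < sup E + e by lra.
have [h|h] := crossR _ _ ee.
  near=> n.
  have h1 : u n < sup E + e by near: n.
  have h2 : a < u n by near: n.
  by rewrite ltr_norml; apply/andP; split; lra.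
by have := ub_le_sup supE.2 h; lra.
Unshelve. all: by end_near. Qed.

Context {d} {T : measurableType d} (P : probability T R).

Lemma ae_cvg0_summable (f : nat -> T -> R) (K : R) :
  (forall n, measurable_fun setT (f n)) -> (forall n w, 0 <= f n w) ->
  (forall N, (\sum_(0 <= n < N) \int[P]_w (f n w)%:E <= K%:E)%E) ->
  {ae P, forall w, f ^~ w @ \oo --> 0}.
Proof.
move=> mf f0 fK.
have f0E n w : (0 <= (f n w)%:E)%E by rewrite lee_fin.
have mfE n : measurable_fun setT (fun w => (f n w)%:E) by apply/measurable_EFinP.
have fi : P.-integrable setT (fun w => \sum_(n <oo) (f n w)%:E)%E.
  apply/integrableP; split; first exact: ge0_emeasurable_sum.
  under eq_integral do rewrite gee0_abs ?nneseries_ge0//.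
  rewrite integral_nneseries//; apply: (@le_lt_trans _ _ K%:E); last exact: ltey.
  apply: lime_le; first by apply: is_cvg_nneseries => n _ _; exact: integral_ge0.
  exact: nearW.
apply: filterS (integrable_ae measurableT fi) => w /(_ I) sfin.
have c : (\sum_(N <= k <oo) (f k w)%:E)%E @[N --> \oo] --> 0%E.
  apply: nneseries_tail_cvg => //; first by rewrite ltey_eq sfin.
suff : (f n w)%:E @[n --> \oo] --> 0%:E by move=> /fine_cvgP[].
apply: (squeeze_cvge _ (cvg_cst 0%E) c); apply: nearW => n; rewrite f0E/=.
rewrite (@nneseries_split _ _ n 1)// addn1 big_nat1 leeDl// nneseries_ge0//.
Qed.

(* V went below a after its last visit above b. *)
Fixpoint upcrossing_state (V : nat -> T -> R) (a b : R) n : set T :=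
  if n is k.+1 then
    [set w | V k.+1 w <= a] `|` (upcrossing_state V a b k `&` [set w | V k.+1 w < b])
  else [set w | V 0%N w <= a].

Context (gens : nat -> set (set T)) (V D : nat -> T -> R) (delta : nat -> R) (K : R).
Hypothesis sub : forall n, <<s gens n>> `<=` @measurable d T.
Hypothesis mono : forall n, <<s gens n>> `<=` <<s gens n.+1>>.
Hypothesis mV : forall n,
  measurable_fun setT (V n : g_sigma_algebraType (gens n) -> R).
Hypothesis V0 : forall n w, 0 <= V n w.
Hypothesis mD : forall n, measurable_fun setT (D n).
Hypothesis D0 : forall n w, 0 <= D n w.
Hypothesis deltaK : forall N, \sum_(0 <= n < N) delta n <= K.
Hypothesis V0oo : (\int[P]_w (V 0%N w)%:E < +oo)%E.
Hypothesis step : forall n S, <<s gens n>> S ->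
  (\int[P]_(w in S) (V n.+1 w)%:E + \int[P]_(w in S) (D n w)%:E
   <= \int[P]_(w in S) (V n w)%:E + (delta n)%:E)%E.

Let mVT n : measurable_fun setT (V n).
Proof.
move=> _ Y mY; rewrite setTI; apply: (@sub n).
by have := @mV n measurableT Y mY; rewrite setTI.
Qed.

Let mVE n S : measurable_fun S (fun w => (V n w)%:E).
Proof. by apply/measurable_EFinP; exact: measurable_funTS. Qed.

Let V0E n (S : set T) w : S w -> (0 <= (V n w)%:E)%E. Proof. by rewrite lee_fin. Qed.

Let FT n : <<s gens n>> setT.
Proof. exact: (@measurableT _ (g_sigma_algebraType (gens n))). Qed.

Let D_ge0 n S : (0 <= \int[P]_(w in S) (D n w)%:E)%E.
Proof. by apply: integral_ge0 => w _; rewrite lee_fin. Qed.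

Let total_bound N : (\int[P]_w (V N w)%:E + \sum_(0 <= n < N) \int[P]_w (D n w)%:E
   <= \int[P]_w (V 0%N w)%:E + (\sum_(0 <= n < N) delta n)%:E)%E.
Proof.
elim: N => [|N IH]; first by rewrite !big_nil.
rewrite !big_nat_recr//= (addeA _ _ (\int[P]_w (D N w)%:E)%E).
rewrite (addeAC _ _ (\int[P]_w (D N w)%:E)%E) EFinD (addeA _ _ (delta N)%:E).
apply: (@le_trans _ _ (\int[P]_w (V N w)%:E + (delta N)%:E
  + \sum_(0 <= n < N) \int[P]_w (D n w)%:E)%E).
  by apply: leeD2r; exact: (@step N setT (@FT N)).
by rewrite addeAC; apply: leeD2r.
Qed.

Let total_le N : (\int[P]_w (V N w)%:E <= \int[P]_w (V 0%N w)%:E + K%:E)%E.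
Proof.
apply: le_trans (le_trans (total_bound N) _).
  by rewrite leeDl// sume_ge0.
by rewrite leeD2l// lee_fin.
Qed.

Let V_fin n S : measurable S -> (\int[P]_(w in S) (V n w)%:E)%E \is a fin_num.
Proof.
move=> mS; rewrite ge0_fin_numE; last by apply: integral_ge0 => w _; rewrite lee_fin.
apply: (@le_lt_trans _ _ (\int[P]_w (V n w)%:E)%E).
  by apply: ge0_subset_integral => // w _; rewrite lee_fin.
by apply: le_lt_trans (total_le n) _; rewrite lte_add_pinfty// ltey.
Qed.

Let v n S : R := fine (\int[P]_(w in S) (V n w)%:E)%E.
Let p (S : set T) : R := fine (P S).

Let vE n S : measurable S -> (\int[P]_(w in S) (V n w)%:E)%E = (v n S)%:E.
Proof. by move=> mS; rewrite fineK// V_fin. Qed.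

Let pE S : measurable S -> P S = (p S)%:E.
Proof. by move=> mS; rewrite fineK// fin_num_measure. Qed.

Let v_setU n S1 S2 : measurable S1 -> measurable S2 -> S1 `&` S2 = set0 ->
  v n (S1 `|` S2) = v n S1 + v n S2.
Proof.
move=> m1 m2 d12; apply: EFin_inj; rewrite EFinD -!vE//; last exact: measurableU.
rewrite ge0_integral_setU//; first by move=> w _; rewrite lee_fin.
by rewrite /disj_set d12.
Qed.

Let p_setU S1 S2 : measurable S1 -> measurable S2 -> S1 `&` S2 = set0 ->
  p (S1 `|` S2) = p S1 + p S2.
Proof.
move=> m1 m2 d12; apply: EFin_inj; rewrite EFinD -!pE//; last exact: measurableU.
by rewrite measureU.
Qed.

Let v_le n S c : measurable S -> (forall w, S w -> V n w <= c) -> v n S <= c * p S.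
Proof.
move=> mS h; rewrite -lee_fin EFinM -vE// -pE// -integral_cst//.
have [->|/set0P[w0 Sw0]] := eqVneq S set0; first by rewrite !integral_set0.
have c0 : 0 <= c by apply: le_trans (h _ Sw0).
by apply: ge0_le_integral => // w Sw; rewrite lee_fin// h.
Qed.

Let v_ge n S c : measurable S -> 0 <= c -> (forall w, S w -> c <= V n w) -> c * p S <= v n S.
Proof.
move=> mS c0 h; rewrite -lee_fin EFinM -vE// -pE// -integral_cst//.
by apply: ge0_le_integral => // w Sw; rewrite lee_fin// h.
Qed.

Let v_step n S : <<s gens n>> S -> v n.+1 S <= v n S + delta n.
Proof.
move=> FS; have mS := @sub n S FS.
rewrite -lee_fin EFinD -!vE//; apply: le_trans (@step n S FS); exact: leeDl.
Qed.

Section Upcrossings.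
Variables (a b : R).
Hypotheses (a0 : 0 <= a) (ab : a < b).
Let st := upcrossing_state V a b.
Let C n := st n `\` st n.+1.

Let F_le n c : <<s gens n>> [set w | V n w <= c].
Proof.
have := @mV n measurableT _ (measurable_itv `]-oo, c]); rewrite setTI.
by congr (<<s gens n>>  _); apply/seteqP; split=> w /=; rewrite in_itv.
Qed.

Let F_lt n c : <<s gens n>> [set w | V n w < c].
Proof.
have := @mV n measurableT _ (measurable_itv `]-oo, c[); rewrite setTI.
by congr (<<s gens n>>  _); apply/seteqP; split=> w /=; rewrite in_itv.
Qed.

Let Fst n : <<s gens n>> (st n).
Proof.
elim: n => [|n IH]; first exact: F_le.
apply: (@measurableU _ (g_sigma_algebraType (gens n.+1))); first exact: F_le.
apply: (@measurableI _ (g_sigma_algebraType (gens n.+1))); last exact: F_lt.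
exact: mono.
Qed.

Let mst n : measurable (st n). Proof. by apply: (@sub n); exact: Fst. Qed.

Let mC n : measurable (C n). Proof. exact: measurableD. Qed.

(* Integrated form of Doob's bound: b - a is lost at each completed crossing C n. *)
Let upcrossing_energy N :
  (b - a) * (\sum_(0 <= n < N) p (C n)) + v N (st N) <= a * p (st N) + \sum_(0 <= n < N) delta n.
Proof.
elim: N => [|N IH].
  rewrite !big_nil mulr0 add0r addr0; apply: v_le => //.
rewrite !big_nat_recr//=.
pose I := st N `&` st N.+1; pose J := st N.+1 `\` st N.
have mI : measurable I by exact: measurableI.
have mJ : measurable J by exact: measurableD.
have CI : C N `&` I = set0 by apply/seteqP; split=> w // [[_ n1] [_ n2]].
have JI : J `&` I = set0 by apply/seteqP; split=> w // [[_ n1] [n2 _]].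
have e1 : st N = C N `|` I.
  apply/seteqP; split=> w; last by move=> [[]|[]].
  by have [] := pselect (st N.+1 w) => h1 h2; [right|left].
have e2 : st N.+1 = J `|` I.
  apply/seteqP; split=> w; last by move=> [[]|[]].
  by have [] := pselect (st N w) => h1 h2; [right|left].
have hC : b * p (C N) <= v N.+1 (C N).
  apply: v_ge => //; first exact: (le_trans a0 (ltW ab)).
  move=> w [sN nsN]; rewrite leNgt; apply/negP => Vb; apply: nsN; right; split => //.
have hJ : v N.+1 J <= a * p J.
  by apply: v_le => // w [[//|[sN _]] nsN].
have hs := v_step (@Fst N).
have q1 : v N.+1 (st N) = v N.+1 (C N) + v N.+1 I by rewrite [in LHS]e1 v_setU.
have q2 : p (st N) = p (C N) + p I by rewrite [in LHS]e1 p_setU.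
have q3 : v N.+1 (st N.+1) = v N.+1 J + v N.+1 I by rewrite [in LHS]e2 v_setU.
have q4 : p (st N.+1) = p J + p I by rewrite [in LHS]e2 p_setU.
rewrite q3 q4; move: IH hs; rewrite q1 q2; move: hC hJ.
move: (\sum_(0 <= n < N) p (C n)) (\sum_(0 <= n < N) delta n) => sC sd.
nra.
Qed.

Lemma ae_no_upcrossing : {ae P, forall w,
  (\forall n \near \oo, V n w < b) \/ (\forall n \near \oo, a < V n w)}.
Proof.
have : P (lim_sup_set C) = 0%E.
  apply: lim_sup_set_cvg0 => //.
  apply: (@le_lt_trans _ _ ((a + K) / (b - a))%:E); last exact: ltey.
  apply: lime_le; first by apply: is_cvg_nneseries.
  apply: nearW => N.
  rewrite (eq_bigr (fun i => (p (C i))%:E)); last by move=> i _; exact: pE.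
  rewrite sumEFin lee_fin ler_pdivlMr ?subr_gt0// mulrC.
  have := upcrossing_energy N; have := deltaK N.
  have : 0 <= v N (st N) by apply: fine_ge0; apply: integral_ge0 => w _; rewrite lee_fin.
  have : a * p (st N) <= a.
    rewrite ler_piMr// -lee_fin -pE//; exact: probability_le1.
  lra.
move=> C0; exists (lim_sup_set C); split => //.
  by apply: bigcap_measurable => // n _; exact: bigcup_measurable.
move=> w /=; apply: contra_notP => nlim.
have [N CN] : exists N, forall n, (N <= n)%N -> ~ C n w.
  apply: contrapT => /forallNP h; apply: nlim => N _.
  by have /existsNP[n /not_implyP[Nn /contrapT Cn]] := h N; exists n.
have stay n : (N <= n)%N -> st n w -> st n.+1 w.
  by move=> Nn sn; apply: contrapT => nsn; apply: (CN n).
have [[n0 [Nn0 sn0]]|h] := pselect (exists n, (N <= n)%N /\ st n w).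
  left; exists n0.+1 => // n /=.
  have st_ge m : st (n0 + m)%N w.
    elim: m => [|m IH]; first by rewrite addn0.
    by rewrite addnS; apply: stay => //; rewrite (leq_trans Nn0)// leq_addr.
  case: n => // n; rewrite ltnS => n0n.
  have := st_ge (n.+1 - n0)%N; rewrite subnKC ?leqW//.
  by move=> [/= /le_lt_trans|[]//]; exact.
right; exists N => // n /= Nn; rewrite ltNge; apply/negP => Va; apply: h.
by exists n; split => //; case: n Va Nn => // n Va _; left.
Qed.

End Upcrossings.

Theorem almost_supermartingale_cvg :
  {ae P, forall w, cvg (V ^~ w @ \oo) /\ D ^~ w @ \oo --> 0}.
Proof.
have aeD : {ae P, forall w, D ^~ w @ \oo --> 0}.
  apply: (@ae_cvg0_summable D (v 0%N setT + K)) => // N.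
  rewrite EFinD -vE//; apply: le_trans (le_trans (total_bound N) _).
    by apply: leeDr; apply: integral_ge0 => w _; rewrite lee_fin.
  by rewrite leeD2l// lee_fin.
have aeoo : {ae P, forall w, ~ ((V n w)%:E @[n --> \oo] --> +oo%E)}.
  have mli : measurable_fun setT (fun w => limn_einf (fun n => (V n w)%:E)).
    rewrite /limn_einf; apply: measurableT_comp => //.
    apply: measurable_fun_limn_esup => n.
    exact: measurableT_comp.
  have li0 w : (0 <= limn_einf (fun n => (V n w)%:E))%E.
    rewrite limn_einf_lim; apply: lime_ge; first exact: is_cvg_einfs.
    by apply: nearW => n; apply: le_ereal_inf_tmp => _ [m /= _ <-]; rewrite lee_fin.
  have ili : P.-integrable setT (fun w => limn_einf (fun n => (V n w)%:E)).
    apply/integrableP; split => //.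
    under eq_integral do rewrite gee0_abs//.
    have fat := @fatou _ _ _ P setT measurableT (fun n w => (V n w)%:E)
      (fun n => @mVE n setT) (fun n w => @V0E n setT w).
    apply: le_lt_trans fat _.
    apply: (@le_lt_trans _ _ (\int[P]_w (V 0%N w)%:E + K%:E)%E); last first.
      by rewrite lte_add_pinfty// ltey.
    rewrite limn_einf_lim; apply: lime_le; first exact: is_cvg_einfs.
    apply: nearW => n; apply: le_trans (total_le n).
    by apply: ereal_inf_lbound; exists n => /=.
  apply: filterS (integrable_ae measurableT ili) => w /(_ I) /[swap] Voo.
  by rewrite (cvg_limn_einf_sup Voo).1.
have aec : {ae P, forall w, forall k : nat, forall a b : rat,
    choice.unpickle k = Some (a, b) -> a < b ->
    (\forall n \near \oo, V n w < ratr b) \/ (\forall n \near \oo, ratr a < V n w)}.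
  apply: ae_foralln => k.
  case: (choice.unpickle k) => [[a b]|]; last by apply: aeW.
  have [ab|ab] := ltP a b; last first.
    by apply: aeW => w a' b' [<- <-]; rewrite ltNge ab.
  have [a0|a0] := leP 0 a.
    have a0R : 0 <= ratr a :> R by rewrite ler0q.
    have abR : ratr a < ratr b :> R by rewrite ltr_rat.
    by apply: filterS (ae_no_upcrossing a0R abR) => w h a' b' [<- <-].
  apply: aeW => w a' b' [<- <-] _; right; apply: nearW => n.
  by apply: lt_le_trans (V0 n w); rewrite ltrq0.
apply: filterS3 aeD aeoo aec => w Dw nVoo cross; split => //.
have [M VM] : exists M, ~ (\forall n \near \oo, M <= V n w).
  apply: contrapT => /forallNP h; apply: nVoo; apply/cvgeyPge => M.
  by have /contrapT := h M.
apply: (cvg_no_upcrossing _ VM) => // a b ab.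
by apply: (cross (choice.pickle (a, b))) => //; rewrite choice.pickleK.
Qed.

End AlmostSupermartingales.

(** * The iteration *)

Lemma dense_seq_in {R : realType} {H : normedModType R} (s : nat -> H) (Z : set H) :
  (forall x e, 0 < e -> exists n, `|x - s n| < e) -> Z !=set0 ->
  exists z : nat -> H, (forall i, Z (z i)) /\
    forall x e, Z x -> 0 < e -> exists i, `|x - z i| < e.
Proof.
move=> sP [z0 Zz0].
have /choice[f fP] (c : nat * nat) : exists z, Z z /\
    ((exists2 z', Z z' & `|z' - s c.1| < c.2.+1%:R^-1) -> `|z - s c.1| < c.2.+1%:R^-1).
  have [[z Zz zs]|h] := pselect (exists2 z', Z z' & `|z' - s c.1| < c.2.+1%:R^-1).
    by exists z.
  by exists z0.
exists (fun n => f (odflt (0%N, 0%N) (choice.unpickle n))); split.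
  by move=> i; have [] := fP (odflt (0%N, 0%N) (choice.unpickle i)).
move=> x e Zx e0.
have [k ke] : exists k : nat, 2 * k.+1%:R^-1 < e.
  exists (Num.trunc (2 / e)).
  by rewrite ltr_pdivrMr// mulrC -ltr_pdivrMr//; exact: truncnS_gt.
have k0 : 0 < k.+1%:R^-1 :> R by rewrite invr_gt0.
have [i xi] := sP x _ k0.
exists (choice.pickle (i, k)); rewrite choice.pickleK /=.
have [_ /(_ (ex_intro2 _ _ x Zx xi)) /= fi] := fP (i, k).
rewrite -(subrK (s i) x) -addrA; apply: le_lt_trans (ler_normD _ _) _.
by rewrite (distrC (s i)); apply: lt_trans ke; move: xi fi; set q := k.+1%:R^-1; lra.
Qed.

Lemma ip_cvg0 {R : realType} {H : normedModType R} {ip : H -> H -> R} (v : nat -> H) :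
  inner_product ip -> ip (v n) (v n) @[n --> \oo] --> 0 -> v @ \oo --> 0.
Proof.
move=> ipP v0; apply: norm_cvg0.
have -> : (fun n => `|v n|) = (fun n => Num.sqrt (ip (v n) (v n))).
  by apply/funext => n; rewrite -(ip_sqr ipP) sqrtr_sqr normr_id.
have : Num.sqrt (ip (v n) (v n)) @[n --> \oo] --> Num.sqrt (0 : R).
  exact: (cvg_comp _ _ v0 (@sqrt_continuous R 0)).
by rewrite sqrtr0.
Qed.

Section Iteration.
Context {R : realType} {H : completeNormedModType R} {ip : H -> H -> R}.
Context {A : H -> set H} {B : H -> H} {mu tau : R} {gamma : nat -> R}.
Hypothesis ipP : inner_product ip.
Hypothesis maxA : maximally_monotone ip A.
Hypothesis mB : monotone_op ip B.
Hypothesis mu0 : 0 < mu.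
Hypothesis lipB : lipschitz_op mu B.
Hypothesis tau0 : 0 < tau.
Hypothesis gamma0 : forall n, 0 < gamma n.
Hypothesis gamma_le : forall n, gamma n <= gamma n.+1.
Hypothesis tau_le1 : forall n, tau + mu * (1 + Num.sqrt 2) <= (gamma n)^-1.
Hypothesis tau_le2 : forall n,
  tau + mu * (1 + Num.sqrt 2) <= 2 * (gamma n.+1)^-1 - (gamma n)^-1.

Let b n := (gamma n)^-1.

Let b_le n : b n.+1 <= b n.
Proof. by rewrite lef_pV2 ?posrE. Qed.

Let b_gt0 n : 0 < b n.
Proof. by rewrite invr_gt0. Qed.

Section Path.
Variables (xm1 : H) (x r : nat -> H).
Let y n := 2 *: x n - step_prev xm1 x n.
Let u n := x n.+1 - x n.
Let e n := r n - B (y n).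
Let p n := - (b n *: u n) - r n.

Definition energy (xs : H) n : R :=
  lyap (ip := ip) mu (b n.+1) (b n) (x n.+2 - xs) (u n.+1) (x n.+2 - y n.+1) (B (y n.+1) - B xs).

Let y_subr n z : y n.+1 - z = x n.+1 - z + u n.
Proof.
rewrite /y /u /= scaler_nat mulr2n -!addrA; congr (_ + _).
by rewrite [RHS]addrCA; congr (_ + _); exact: addrC.
Qed.

Let xy n : x n.+2 - y n.+1 = u n.+1 - u n.
Proof. by rewrite -opprB y_subr /u opprD opprB. Qed.

Lemma energy_ge xs n : mu * ip (x n.+2 - xs) (x n.+2 - xs) <= energy xs n.
Proof.
apply: (@lyap_ge _ _ _ ipP mu tau (b n.+1) (b n)) => //.
  by apply: le_trans (tau_le1 n.+1); rewrite lerDr ltW.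
  exact: tau_le2.
have -> : x n.+2 - xs - (x n.+2 - y n.+1) = y n.+1 - xs.
  by rewrite opprB addrC addrA subrK.
exact: lipB.
Qed.

Hypothesis res : forall n, resolvent (gamma n) A (x n - gamma n *: r n) (x n.+1).

Let A_p n : A (x n.+1) (p n).
Proof.
have [a Aa e1] := res n; suff -> : p n = a by [].
have g1 : gamma n != 0 by rewrite gt_eqF.
have e2 : gamma n *: a = x n - x n.+1 - gamma n *: r n.
  by rewrite addrAC e1 addrC addKr.
rewrite /p /u -scalerN opprB.
by rewrite -[a]scale1r -(mulVf g1) -scalerA e2 [RHS]scalerBr scalerA mulVf// scale1r.
Qed.

Lemma energy_decrease xs n : zer A B xs ->
  energy xs n.+1 + tau / 2 * ip (u n.+1) (u n.+1)
    + 2 * ip (e n.+2) (x n.+2 - xs + u n.+1 + u n.+1)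
  <= energy xs n + 16 / tau * (ip (e n.+2) (e n.+2) + ip (e n.+1) (e n.+1)).
Proof.
move=> [a Aa aB].
have {aB} Axs : A xs (- B xs) by have -> : - B xs = a by apply/eqP; rewrite eq_sym -addr_eq0 aB.
have sv : x n.+2 - xs + u n.+2 = x n.+3 - xs by rewrite /u addrC addrA subrK.
have pE k : - (b k *: u k) - (B (y k) - B xs) - e k = p k + B xs.
  rewrite /p /e !opprB -addrA (addrA (B xs - B (y k))) subrK -[RHS]addrA.
  by congr (_ + _); exact: addrC.
rewrite /energy -sv xy.
apply: (lyap_step ipP mu0 tau0) => //.
- exact: tau_le1.
- exact: tau_le2.
- rewrite opprB addrA subrK.
  have -> : u n.+1 + (x n.+2 - y n.+1) = y n.+2 - y n.+1 by rewrite y_subr addrC.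
  exact: lipB.
- rewrite -y_subr; exact: mB.
- rewrite pE sv -[B xs]opprK; exact: (maxA.1 _ _ _ _ (A_p n.+2) Axs).
- rewrite !pE opprD addrACA subrr addr0; exact: (maxA.1 _ _ _ _ (A_p n.+2) (A_p n.+1)).
Qed.

Hypothesis u_cvg : ip (u n.+1) (u n.+1) @[n --> \oo] --> 0.

Let u0 : u @ \oo --> 0.
Proof. by rewrite -(cvg_shiftS u); exact: (ip_cvg0 ipP u_cvg). Qed.

Let q0 : (x n.+2 - y n.+1) @[n --> \oo] --> (0 : H).
Proof.
have -> : (fun n => x n.+2 - y n.+1) = (fun n => u n.+1 - u n).
  by apply/funext => n; rewrite xy.
rewrite -[X in _ --> X](@subrr _ (0 : H)).
by apply: (cvgB _ u0); rewrite (cvg_shiftS u).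
Qed.

Let cvg0_mul (f g : nat -> R) (M : R) : (forall n, `|f n| <= M) -> g @ \oo --> 0 ->
  (fun n => f n * g n) @ \oo --> 0.
Proof.
move=> fM g0; apply: norm_cvg0.
have c1 : M * `|g n| @[n --> \oo] --> (0 : R).
  by rewrite -(mulr0 M) -(@normr0 _ R); exact: (cvgMl_tmp (a := M) (cvg_norm g0)).
apply: (squeeze_cvgr _ (cvg_cst 0) c1); apply: nearW => n.
by rewrite normr_ge0/= normrM ler_wpM2r.
Qed.

Lemma energy_cvg_dist xs : cvg (energy xs @ \oo) ->
  (exists M, forall n, `|x n.+2 - xs| <= M) /\ cvg (`|x n.+2 - xs| ^+ 2 @[n --> \oo]).
Proof.
move=> Vcvg.
have [M0 M0P] : exists M, forall n, `|x n.+2 - xs| <= M.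
  have [K [_ KP]] := cvg_seq_bounded Vcvg.
  have {}KP n : energy xs n <= K + 1.
    by apply: le_trans (ler_norm _) _; apply: KP => //; rewrite ltrDl.
  exists ((K + 1) / mu + 1) => n.
  have : `|x n.+2 - xs| ^+ 2 <= (K + 1) / mu.
    rewrite ler_pdivlMr// mulrC (ip_sqr ipP); exact: le_trans (energy_ge xs n) (KP n).
  have := normr_ge0 (x n.+2 - xs); set t := `|_|; nra.
split; first by exists M0.
have [Q QP] : exists Q, forall n, `|x n.+2 - y n.+1| <= Q.
  have : cvg ((fun n => x n.+2 - y n.+1) @ \oo) by apply/cvg_ex; exists 0.
  move=> /cvg_seq_bounded[K [_ KP]]; exists (K + 1) => n.
  by apply: KP => //; rewrite ltrDl.
have bcvg : cvg (b @ \oo).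
  apply: nonincreasing_is_cvgn; first exact/nonincreasing_seqP.
  by exists 0 => _ [n _ <-]; exact: ltW.
have blim : 0 < lim (b @ \oo).
  apply: (@lt_le_trans _ _ (tau + mu * (1 + Num.sqrt 2))).
    by rewrite addr_gt0// mulr_gt0// ltr_wpDr// sqrtr_ge0.
  by apply: limr_ge => //; apply: nearW => n; exact: tau_le1.
pose c n := (3 * b n.+1 - b n) * ip (u n.+1) (u n.+1)
   + 2 * ip (B (y n.+1) - B xs) (u n.+1) + mu * ip (x n.+2 - y n.+1) (x n.+2 - y n.+1).
have b_le0 n : b n <= b 0%N by elim: n => // n; exact: le_trans.
have c0 : c @ \oo --> 0.
  have c1 : (3 * b n.+1 - b n) * ip (u n.+1) (u n.+1) @[n --> \oo] --> 0.
    apply: (@cvg0_mul _ _ (4 * b 0%N)) => // n.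
    have := b_gt0 n; have := b_gt0 n.+1; have := b_le0 n; have := b_le0 n.+1.
    by move=> *; rewrite ler_norml; apply/andP; split; lra.
  have c2 : ip (B (y n.+1) - B xs) (u n.+1) @[n --> \oo] --> 0.
    have nu0 : `|u n.+1| @[n --> \oo] --> (0 : R).
      by rewrite -(@normr0 _ H); apply: cvg_norm; rewrite (cvg_shiftS u).
    have := @cvg0_mul (fun=> mu * (M0 + Q)) _ `|mu * (M0 + Q)| (fun=> lexx _) nu0.
    move=> h; apply: norm_cvg0.
    apply: (squeeze_cvgr _ (cvg_cst 0) h); apply: nearW => n.
    rewrite normr_ge0/=; apply: le_trans (ip_cauchy_schwarz ipP _ _) _.
    rewrite ler_wpM2r//; apply: le_trans (lipB _ _) _; rewrite ler_wpM2l ?(ltW mu0)//.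
    have -> : y n.+1 - xs = (x n.+2 - xs) - (x n.+2 - y n.+1).
      by rewrite opprB [RHS]addrC addrA subrK.
    by apply: le_trans (ler_normB _ _) _; apply: lerD.
  have c3 : ip (x n.+2 - y n.+1) (x n.+2 - y n.+1) @[n --> \oo] --> 0.
    have nq0 : `|x n.+2 - y n.+1| @[n --> \oo] --> (0 : R).
      by rewrite -(@normr0 _ H); exact: cvg_norm.
    have -> : (fun n => ip (x n.+2 - y n.+1) (x n.+2 - y n.+1)) =
       (fun n => `|x n.+2 - y n.+1| * `|x n.+2 - y n.+1|).
      by apply/funext => n; rewrite -expr2 (ip_sqr ipP).
    by apply: (@cvg0_mul _ _ Q) => // n; rewrite normr_id.
  have := cvgD (cvgD c1 (cvgMl_tmp (a := 2) c2)) (cvgMl_tmp (a := mu) c3).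
  by rewrite !mulr0 !addr0; apply.
have -> : (fun n => `|x n.+2 - xs| ^+ 2) = (fun n => (energy xs n - c n) * (b n.+1)^-1).
  apply/funext => n; rewrite (ip_sqr ipP) /energy /lyap /c.
  by field; rewrite gt_eqF.
move/cvg_ex : Vcvg => [/= l Vl].
apply/cvg_ex; exists (l * (lim (b @ \oo))^-1); rewrite -[X in X * _]subr0.
apply: (cvgM (cvgB Vl c0)); apply: cvgV; first by rewrite gt_eqF.
by rewrite (cvg_shiftS b).
Qed.

Hypothesis e_cvg : ip (e n) (e n) @[n --> \oo] --> 0.

Lemma iterates_weak_cvg (Z : nat -> H) :
  (forall i, zer A B (Z i)) ->
  (forall z d, zer A B z -> 0 < d -> exists i, `|z - Z i| < d) ->
  (forall i, cvg (energy (Z i) @ \oo)) ->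
  exists2 z, zer A B z & weak_cvg ip x z.
Proof.
move=> ZZ Zd Zc.
have [[M MP] _] := energy_cvg_dist (Zc 0%N).
have [|||||z Zz xz] := @opial_zer _ _ _ ipP A B mu (M + `|Z 0%N|) (range Z)
  (fun n => x n.+2) (fun n => p n.+1) maxA mB mu0 lipB.
- by move=> z d Zz d0; have [i zi] := Zd _ _ Zz d0; exists (Z i).
- by move=> _ [i _ <-]; have [] := energy_cvg_dist (Zc i).
- move=> n; rewrite -(subrK (Z 0%N) (x n.+2)).
  by apply: le_trans (ler_normD _ _) _; rewrite lerD2r.
- by move=> n; exact: A_p.
- have ne : `|e n| @[n --> \oo] --> (0 : R).
    by rewrite -(@normr0 _ H); apply: cvg_norm; exact: (ip_cvg0 ipP e_cvg).
  have nu : `|u n.+1| @[n --> \oo] --> (0 : R).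
    by rewrite -(@normr0 _ H); apply: cvg_norm; rewrite (cvg_shiftS u).
  have nq : `|x n.+2 - y n.+1| @[n --> \oo] --> (0 : R).
    by rewrite -(@normr0 _ H); exact: cvg_norm.
  have h : b 0%N * `|u n.+1| + `|e n.+1| + mu * `|x n.+2 - y n.+1| @[n --> \oo] --> (0 : R).
    have ne1 : `|e n.+1| @[n --> \oo] --> (0 : R) by rewrite (cvg_shiftS (fun n => `|e n|)).
    have := cvgD (cvgD (cvgMl_tmp (a := b 0%N) nu) ne1) (cvgMl_tmp (a := mu) nq).
    by rewrite !mulr0 !addr0; apply.
  apply: norm_cvg0; apply: (squeeze_cvgr _ (cvg_cst 0) h); apply: nearW => n.
  rewrite normr_ge0/=.
  have -> : p n.+1 + B (x n.+2) = - (b n.+1 *: u n.+1) - e n.+1 + (B (x n.+2) - B (y n.+1)).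
    rewrite /p /e opprB -[LHS]addrA -[RHS]addrA; congr (_ + _).
    by rewrite [RHS]addrC addrA subrK; exact: addrC.
  apply: le_trans (ler_normD _ _) _; apply: lerD; last exact: lipB.
  apply: le_trans (ler_normB _ _) _; rewrite lerD2r normrN normrZ gtr0_norm//.
  have b_le0 k : b k <= b 0%N by elim: k => // k; exact: le_trans.
  by rewrite ler_wpM2r.
exists z => // h.
have : (fun n => ip (x (n + 2)%N) h) @ \oo --> ip z h.
  have -> : (fun n => ip (x (n + 2)%N) h) = (fun n => ip (x n.+2) h).
    by apply/funext => n; rewrite addn2.
  exact: xz.
by rewrite (cvg_shiftn 2 (fun n => ip (x n) h)).
Qed.

End Path.
End Iteration.

Section Stochastic.
Context {R : realType} {H : completeNormedModType R} {ip : H -> H -> R}.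
Context {d : measure_display} {Omega : measurableType d} {P : probability Omega R}.
Context {A : H -> set H} {B : H -> H} {mu tau : R} {gamma : nat -> R}.
Context {xm1 : Omega -> H} {x r : nat -> Omega -> H} {g : nat -> Omega -> \bar R}.
Context {s : nat -> H}.
Hypothesis ipP : inner_product ip.
Hypothesis sP : forall v e, 0 < e -> exists n, `|v - s n| < e.
Hypothesis maxA : maximally_monotone ip A.
Hypothesis mB : monotone_op ip B.
Hypothesis mu0 : 0 < mu.
Hypothesis lipB : lipschitz_op mu B.
Hypothesis tau0 : 0 < tau.
Hypothesis gamma0 : forall n, 0 < gamma n.
Hypothesis gamma_le : forall n, gamma n <= gamma n.+1.
Hypothesis tau_le1 : forall n, tau + mu * (1 + Num.sqrt 2) <= (gamma n)^-1.
Hypothesis tau_le2 : forall n,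
  tau + mu * (1 + Num.sqrt 2) <= 2 * (gamma n.+1)^-1 - (gamma n)^-1.
Hypothesis mx0 : H_rv (x 0%N).
Hypothesis cond : forall n, condexp_H ip P (natural_filtration x n) (r n)
  (fun w => B (refl_pt xm1 x n w)).
Hypothesis res : forall n w, resolvent (gamma n) A (x n w - gamma n *: r n w) (x n.+1 w).
Hypothesis gP : forall n, condexp_nneg P (natural_filtration x n)
  (fun w => (`|r n w - B (refl_pt xm1 x n w)| ^+ 2)%:E) (g n).
Hypothesis g_lty : {ae P, forall w, (\sum_(0 <= n <oo) g n w < +oo)%E}.

Let gens n := [set S | exists k, exists U : set H,
  [/\ (k <= n)%N, open U & S = x k @^-1` U]].
Let e n w := r n w - B (refl_pt xm1 x n w).
Let u n w := x n.+1 w - x n w.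
Let En xs n w := energy (ip := ip) (B := B) (mu := mu) (gamma := gamma) (xm1 w) (x ^~ w) xs n.

Lemma H_rv_iterates n : H_rv (x n).
Proof.
elim: n => // n IH.
apply: (H_rv_resolvent ipP maxA.1 (gamma0 n) _ (res n)).
by apply: (H_rvB sP) => //; apply: H_rvZ; have [] := cond n.
Qed.

Let F_le m n : (m <= n)%N -> natural_filtration x m `<=` natural_filtration x n.
Proof.
move=> mn; apply: sub_sigma_algebra2 => S [k [U [km oU ->]]].
by exists k, U; split => //; exact: leq_trans mn.
Qed.

Let F_sub n : natural_filtration x n `<=` @measurable d Omega.
Proof.
apply: smallest_sub; first exact: sigma_algebra_measurable.
by move=> S [k [U [_ oU ->]]]; exact: H_rv_iterates.
Qed.

Let Fx k n : (k <= n)%N -> H_rv (x k : g_sigma_algebraType (gens n) -> H).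
Proof.
move=> kn U oU.
have : gens n (x k @^-1` U) by exists k, U.
exact: (@sub_sigma_algebra _ setT (gens n)).
Qed.

Let FBy k n : (k <= n)%N ->
  H_rv ((fun w => B (refl_pt xm1 x k w)) : g_sigma_algebraType (gens n) -> H).
Proof. by move=> kn U oU; have [_ _ mBy _ _] := cond k; exact: (F_le kn (mBy U oU)). Qed.

Let Fg k n : (k <= n)%N -> measurable_fun setT (g k : g_sigma_algebraType (gens n) -> \bar R).
Proof.
move=> kn _ Y mY; rewrite setTI; have [_ mg _] := gP k.
exact: (F_le kn (mg Y mY)).
Qed.

Let g_ge0 k w : (0 <= g k w)%E. Proof. by have [] := gP k. Qed.

Let FEn xs n : measurable_fun setT (En xs n : g_sigma_algebraType (gens n.+2) -> R).
Proof.
rewrite /En /energy /lyap.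
have mx1 : H_rv (x n.+1 : g_sigma_algebraType (gens n.+2) -> H) by exact: Fx.
have mx2 : H_rv (x n.+2 : g_sigma_algebraType (gens n.+2) -> H) by exact: Fx.
have mxn : H_rv (x n : g_sigma_algebraType (gens n.+2) -> H) by apply: Fx; rewrite ltnW.
have mBy := @FBy n.+1 n.+2 (leqnSn _).
pose T2 : measurableType _ := g_sigma_algebraType (gens n.+2).
have mxs : H_rv (fun w : T2 => x n.+2 w - xs) by apply: (H_rvB sP mx2); exact: H_rv_cst.
have mu1 : H_rv (fun w : T2 => x n.+2 w - x n.+1 w) by exact: (H_rvB sP).
have my : H_rv (fun w : T2 => x n.+2 w - (2 *: x n.+1 w - x n w)).
  by apply: (H_rvB sP mx2); apply: (H_rvB sP) => //; exact: H_rvZ.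
have mb : H_rv (fun w : T2 => B (refl_pt xm1 x n.+1 w) - B xs).
  by apply: (H_rvB sP mBy); exact: H_rv_cst.
have m1 := measurable_ip sP ipP mxs mxs.
have m2 := measurable_ip sP ipP mu1 mu1.
have m3 := measurable_ip sP ipP mb mu1.
have m4 := measurable_ip sP ipP my my.
by apply: measurable_funD; [apply: measurable_funD; [apply: measurable_funD|]|];
  apply: measurable_funM.
Qed.

Let mf_sub n (f : Omega -> R) :
  measurable_fun setT (f : g_sigma_algebraType (gens n) -> R) -> measurable_fun setT f.
Proof.
move=> mf _ Y mY; rewrite setTI; apply: (@F_sub n (f @^-1` Y)).
by have := mf measurableT Y mY; rewrite setTI.
Qed.

Let mEn xs n : measurable_fun setT (En xs n).
Proof. exact: mf_sub (@FEn xs n). Qed.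

Let me n : H_rv (e n).
Proof.
have [mr _ mBy _ _] := cond n; apply: (H_rvB sP mr) => U oU.
exact: (F_sub (mBy U oU)).
Qed.

Let mee n : measurable_fun setT (fun w => ip (e n w) (e n w)).
Proof. exact: (measurable_ip sP ipP). Qed.

Let muu n : measurable_fun setT (fun w => ip (u n w) (u n w)).
Proof.
by apply: (measurable_ip sP ipP); apply: (H_rvB sP); exact: H_rv_iterates.
Qed.

Let En_ge0 xs n w : 0 <= En xs n w.
Proof.
apply: le_trans (energy_ge ipP mu0 lipB tau0 tau_le1 tau_le2 _ _ _ _).
by rewrite mulr_ge0 ?(ip_ge0 ipP)// ltW.
Qed.

Let integral_indic (S E : set Omega) (f : Omega -> R) : measurable E ->
  (\int[P]_(w in S) (f w * \1_E w)%:E = \int[P]_(w in S `&` E) (f w)%:E)%E.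
Proof.
move=> mE; rewrite integral_mkcondr; apply: eq_integral => w _.
by rewrite patchE indicE; case: ifP => _; rewrite ?mulr1 ?mulr0.
Qed.

Section Localization.
Variables (xs : H) (m : R).
Hypotheses (Zxs : zer A B xs) (m0 : 0 <= m).

Let Tm j := [set w | (\sum_(0 <= k < j) g k w <= m%:E)%E].
Let Lm := [set w | En xs 0%N w <= m].
Let Am n := Lm `&` Tm n.+2.

Let FTm j : natural_filtration x j (Tm j.+1).
Proof.
have mg : measurable_fun setT
    ((fun w => \sum_(0 <= k < j.+1) g k w)%E : g_sigma_algebraType (gens j) -> \bar R).
  under eq_fun do rewrite big_mkord.
  by apply: emeasurable_sum => k; apply: Fg; rewrite -ltnS.
have := mg measurableT _ (emeasurable_itv `]-oo, m%:E]); rewrite setTI.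
by congr (natural_filtration x j _); apply/seteqP; split=> w /=; rewrite in_itv.
Qed.

Let Tm_le j k : (j <= k)%N -> Tm k `<=` Tm j.
Proof.
move=> jk w /=; apply: le_trans.
by rewrite (big_cat_nat _ jk)//= leeDl// sume_ge0.
Qed.

Let FLm n : natural_filtration x n.+2 Lm.
Proof.
apply: (@F_le 2 n.+2) => //.
have := @FEn xs 0%N measurableT _ (measurable_itv `]-oo, m]); rewrite setTI.
by congr (natural_filtration x 2 _); apply/seteqP; split=> w /=; rewrite in_itv.
Qed.

Let FAm1 n : natural_filtration x n.+2 (Am n.+1).
Proof.
rewrite /Am; apply: (@measurableI _ (g_sigma_algebraType (gens n.+2)) Lm (Tm n.+3)).
  exact: FLm.
exact: FTm.
Qed.

Let FAm n : natural_filtration x n.+2 (Am n).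
Proof.
rewrite /Am; apply: (@measurableI _ (g_sigma_algebraType (gens n.+2)) Lm (Tm n.+2)).
  exact: FLm.
by apply: (@F_le n.+1) => //; exact: FTm.
Qed.

Let mTm j : measurable (Tm j.+1). Proof. by apply: (@F_sub j); exact: FTm. Qed.
Let mAm n : measurable (Am n). Proof. by apply: (@F_sub n.+2); exact: FAm. Qed.

Let Q k := (\int[P]_(w in Tm k.+1) (ip (e k w) (e k w))%:E)%E.

Let integral_m : (\int[P]_w (cst m%:E) w = m%:E)%E.
Proof.
have PT : (P : {measure set Omega -> \bar R}) setT = 1%E := probability_setT P.
by rewrite integral_cst// PT mule1.
Qed.

Let Q_sum N : (\sum_(0 <= k < N) Q k <= m%:E)%E.
Proof.
have QE k : Q k = (\int[P]_w (g k \_ (Tm k.+1)) w)%E.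
  rewrite -integral_mkcond; have [_ _ ->] := gP k; last exact: FTm.
  by apply: eq_integral => w _; rewrite -(ip_sqr ipP).
have mg k : measurable_fun setT (g k).
  move=> _ Y mY; rewrite setTI; apply: (@F_sub k (g k @^-1` Y)).
  by have := @Fg k k (leqnn k) measurableT Y mY; rewrite setTI.
rewrite (eq_bigr (fun k => \int[P]_w (g k \_ (Tm k.+1)) w)%E); last by move=> k _; exact: QE.
rewrite -ge0_integral_sum//; last 2 first.
- move=> k; apply/(measurable_restrictT _ (mTm k)); exact: measurable_funTS.
- by move=> k w _; apply: erestrict_ge0 => ? _; exact: g_ge0.
apply: (@le_trans _ _ (\int[P]_w (cst m%:E) w)%E); last first.
  by rewrite integral_m.
apply: ge0_le_integral => //.
- by move=> w _; apply: sume_ge0 => k _; apply: erestrict_ge0 => ? _; exact: g_ge0.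
- apply: emeasurable_sum => k.
  by apply/(measurable_restrictT _ (mTm k)); exact: measurable_funTS.
move=> w _ /=.
have mE0 : (0 <= m%:E)%E by rewrite lee_fin.
elim: N => [|N IH]; first by rewrite big_nil.
have [wN|wN] := pselect (Tm N.+1 w); last first.
  by rewrite big_nat_recr//= patchE memNset// adde0.
apply: le_trans wN; apply: lee_sum => k _.
by rewrite patchE; case: ifP => // _; exact: g_ge0.
Qed.

Let Q_ge0 k : (0 <= Q k)%E.
Proof. by apply: integral_ge0 => w _; rewrite lee_fin (ip_ge0 ipP). Qed.

Let Q_fin k : Q k \is a fin_num.
Proof.
rewrite ge0_fin_numE//; apply: (@le_lt_trans _ _ m%:E); last exact: ltey.
by apply: le_trans (Q_sum k.+1); rewrite big_nat_recr//= leeDr// sume_ge0.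
Qed.

Let q k : R := fine (Q k).

Let q_sum N : \sum_(0 <= k < N) q k <= m.
Proof.
rewrite -lee_fin -sumEFin; apply: le_trans (Q_sum N).
by apply: lee_sum => k _; rewrite /q fineK.
Qed.

Let q_sumD j N : \sum_(0 <= k < N) q (k + j)%N <= m.
Proof.
have -> : \sum_(0 <= k < N) q (k + j)%N = \sum_(j <= k < N + j) q k.
  by rewrite -[in RHS](add0n j) big_addn add0n addnK.
apply: le_trans (q_sum (N + j)).
rewrite [leRHS](@big_cat_nat _ _ _ j)//= ?leq_addl//.
by rewrite lerDr sumr_ge0// => k _; apply: fine_ge0.
Qed.

Let V n w := En xs n w * \1_(Am n) w.
Let D n w := tau / 2 * ip (u n.+1 w) (u n.+1 w) * \1_(Am n.+1) w.
Let delta n := 16 / tau * (q n.+2 + q n.+1).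

Let t16 : 0 < 16 / tau. Proof. by rewrite divr_gt0. Qed.

Let V_decrease n S : natural_filtration x n.+2 S ->
  (\int[P]_(w in S) (V n.+1 w)%:E + \int[P]_(w in S) (D n w)%:E
   <= \int[P]_(w in S) (V n w)%:E + (delta n)%:E)%E.
Proof.
move=> FS; have mS := @F_sub _ _ FS.
rewrite !integral_indic//.
pose S' := S `&` Am n.+1.
have FS' : natural_filtration x n.+2 S'.
  apply: (@measurableI _ (g_sigma_algebraType (gens n.+2)) S (Am n.+1)) => //.
  exact: FAm1.
have mS' : measurable S' by exact: F_sub FS'.
have mfS (f : Omega -> R) E : measurable_fun setT f -> measurable_fun E (fun w => (f w)%:E).
  by move=> mf; apply/measurable_EFinP; exact: measurable_funTS.
have ee0 k w : 0 <= ip (e k w) (e k w) by exact: ip_ge0.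
have mD' : measurable_fun setT (fun w => tau / 2 * ip (u n.+1 w) (u n.+1 w)).
  exact: measurable_funM.
have D'0 w : 0 <= tau / 2 * ip (u n.+1 w) (u n.+1 w).
  by rewrite mulr_ge0 ?(ip_ge0 ipP)// divr_ge0// ltW.
have mE' : measurable_fun setT
    (fun w => 16 / tau * (ip (e n.+2 w) (e n.+2 w) + ip (e n.+1 w) (e n.+1 w))).
  by apply: measurable_funM => //; exact: measurable_funD.
have E'0 w : 0 <= 16 / tau * (ip (e n.+2 w) (e n.+2 w) + ip (e n.+1 w) (e n.+1 w)).
  by rewrite mulr_ge0 ?(ltW t16)// addr_ge0.
rewrite -/S' -ge0_integralD//; [|by move=> w _; rewrite lee_fin|exact: mfS
  |by move=> w _; rewrite lee_fin|exact: mfS].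
have key := @condexp_H_le_integral _ _ _ _ _ _ ipP sP P (gens n.+2) (r n.+2)
  (fun w => B (refl_pt xm1 x n.+2 w)) (fun w => x n.+2 w - xs + u n.+1 w + u n.+1 w)
  (fun w => En xs n.+1 w + tau / 2 * ip (u n.+1 w) (u n.+1 w))
  (fun w => En xs n w + 16 / tau * (ip (e n.+2 w) (e n.+2 w) + ip (e n.+1 w) (e n.+1 w)))
  S' (@F_sub n.+2) (cond n.+2).
apply: (@le_trans _ _ (\int[P]_(w in S') (En xs n w +
     16 / tau * (ip (e n.+2 w) (e n.+2 w) + ip (e n.+1 w) (e n.+1 w)))%:E)%E).
  apply: key => //.
  - have mx1 : H_rv (x n.+1 : g_sigma_algebraType (gens n.+2) -> H) by exact: Fx.
    have mx2 : H_rv (x n.+2 : g_sigma_algebraType (gens n.+2) -> H) by exact: Fx.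
    have mu1 : H_rv (u n.+1 : g_sigma_algebraType (gens n.+2) -> H) by exact: (H_rvB sP).
    apply: (H_rvD sP (T := g_sigma_algebraType (gens n.+2))) => //.
    apply: (H_rvD sP (T := g_sigma_algebraType (gens n.+2))) => //.
    by apply: (H_rvB sP mx2); exact: H_rv_cst.
  - exact: measurable_funD.
  - exact: measurable_funD.
  - by move=> w; rewrite addr_ge0.
  - by move=> w; rewrite addr_ge0.
  - by move=> w; apply: (energy_decrease ipP maxA mB mu0 lipB tau0 gamma0 gamma_le
      tau_le1 tau_le2 (xm1 w) (fun k => res k w)).
have -> : (\int[P]_(w in S') (En xs n w +
     16 / tau * (ip (e n.+2 w) (e n.+2 w) + ip (e n.+1 w) (e n.+1 w)))%:E =
  \int[P]_(w in S') (En xs n w)%:E + (16 / tau)%:E *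
   (\int[P]_(w in S') (ip (e n.+2 w) (e n.+2 w))%:E +
    \int[P]_(w in S') (ip (e n.+1 w) (e n.+1 w))%:E))%E.
  under eq_integral do rewrite EFinD.
  rewrite ge0_integralD//; [|by move=> w _; rewrite lee_fin|exact: mfS
    |by move=> w _; rewrite lee_fin|exact: mfS].
  congr (_ + _)%E.
  rewrite -ge0_integralD//; [|by move=> w _; rewrite lee_fin|exact: mfS
    |by move=> w _; rewrite lee_fin|exact: mfS].
  rewrite -ge0_integralZl_EFin ?(ltW t16)//.
  - by move=> w _; rewrite -EFinD lee_fin addr_ge0.
  - by apply: emeasurable_funD; exact: mfS.
apply: leeD.
  apply: ge0_subset_integral => //; [exact: measurableI|exact: mfS|by move=> w _; rewrite lee_fin|].
  by apply: setIS; apply: setIS; exact: Tm_le.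
rewrite /delta (EFinM (16 / tau)) lee_pmul2l ?lte_fin// EFinD; apply: leeD; rewrite /q fineK//.
- apply: ge0_subset_integral => //; [exact: mfS|by move=> w _; rewrite lee_fin|by move=> w [_ []]].
- apply: ge0_subset_integral => //; [exact: mfS|by move=> w _; rewrite lee_fin|].
  by move=> w [_ [_]]; exact: Tm_le.
Qed.

Lemma ae_localized_cvg : {ae P, forall w, (forall n, Am n w) ->
  [/\ cvg (En xs ^~ w @ \oo), ip (u n.+1 w) (u n.+1 w) @[n --> \oo] --> 0
    & ip (e n w) (e n w) @[n --> \oo] --> 0]}.
Proof.
have mV n : measurable_fun setT (V n : g_sigma_algebraType (gens n.+2) -> R).
  apply: measurable_funM; first exact: FEn.
  by apply: measurable_indic; exact: FAm.
have aeV : {ae P, forall w, cvg (V ^~ w @ \oo) /\ D ^~ w @ \oo --> 0}.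
  apply: (@almost_supermartingale_cvg R d Omega P (fun n => gens n.+2) V D delta
    (16 / tau * (m + m))) => //.
  - by move=> n; exact: F_sub.
  - by move=> n; exact: F_le.
  - by move=> n w; rewrite mulr_ge0.
  - move=> n; apply: measurable_funM; first exact: measurable_funM.
    exact: measurable_indic.
  - by move=> n w; rewrite !mulr_ge0 ?(ip_ge0 ipP)// ?invr_ge0 ltW.
  - move=> N; rewrite -mulr_sumr ler_pM2l// big_split/=; apply: lerD.
      by under eq_bigr do rewrite -addn2; exact: q_sumD.
    by under eq_bigr do rewrite -addn1; exact: q_sumD.
  - apply: (@le_lt_trans _ _ (\int[P]_w (cst m%:E) w)%E); last first.
      by rewrite integral_m ltry.
    apply: ge0_le_integral => //.
    + by move=> w _; rewrite lee_fin mulr_ge0.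
    + by apply/measurable_EFinP; exact: mf_sub (mV 0%N).
    move=> w _ /=; rewrite lee_fin /V indicE.
    have [wA|_] := boolP (w \in _); last by rewrite mulr0.
    by rewrite mulr1; move: wA; rewrite inE => -[].
have aee : {ae P, forall w, ip (e n w) (e n w) * \1_(Tm n.+1) w @[n --> \oo] --> 0}.
  apply: (@ae_cvg0_summable R d Omega P
    (fun n w => ip (e n w) (e n w) * \1_(Tm n.+1) w) m) => //.
  - by move=> n; apply: measurable_funM => //; exact: measurable_indic.
  - by move=> n w; rewrite mulr_ge0 ?(ip_ge0 ipP).
  - move=> N; apply: le_trans (Q_sum N); apply: lee_sum => k _.
    by rewrite integral_indic// setTI.
apply: filterS2 aeV aee => w [Vw Dw] ew wA.
have A1 n : \1_(Am n) w = 1 :> R by rewrite indicE mem_set.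
split.
- by have <- : V ^~ w = En xs ^~ w by apply/funext => n; rewrite /V A1 mulr1.
- have -> : (fun n => ip (u n.+1 w) (u n.+1 w)) = (fun n => 2 / tau * D n w).
    by apply/funext => n; rewrite /D A1; field; rewrite gt_eqF.
  by rewrite -(mulr0 (2 / tau)); exact: (cvgMl_tmp (a := 2 / tau) Dw).
- suff <- : (fun n => ip (e n w) (e n w) * \1_(Tm n.+1) w) = (fun n => ip (e n w) (e n w)) by [].
  apply/funext => n; rewrite indicE mem_set ?mulr1//.
  by apply: (@Tm_le _ n.+2) => //; have [] := wA n.
Qed.

End Localization.

Lemma ae_energy_cvg xs : zer A B xs -> {ae P, forall w,
  [/\ cvg (En xs ^~ w @ \oo), ip (u n.+1 w) (u n.+1 w) @[n --> \oo] --> 0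
    & ip (e n w) (e n w) @[n --> \oo] --> 0]}.
Proof.
move=> Zxs.
have h := ae_foralln (fun m : nat => ae_localized_cvg Zxs (ler0n R m)).
apply: filterS2 h g_lty => w hw goo.
have G0 : (0 <= \sum_(0 <= n <oo) g n w)%E by exact: nneseries_ge0.
pose m := (Num.trunc (Num.max (En xs 0%N w) (fine (\sum_(0 <= n <oo) g n w)%E))).+1.
have /ltW := truncnS_gt (Num.max (En xs 0%N w) (fine (\sum_(0 <= n <oo) g n w)%E)).
rewrite -/m ge_max => /andP[Em gm].
apply: (hw m) => n; split => //=.
apply: le_trans (nneseries_lim_ge _ _) _ => //.
have Gfin : (\sum_(0 <= n <oo) g n w)%E \is a fin_num by rewrite ge0_fin_numE.
by rewrite -(fineK Gfin) lee_fin.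
Qed.

Lemma ae_iterates_weak_cvg : zer A B !=set0 ->
  {ae P, forall w, exists2 z, zer A B z & weak_cvg ip (x ^~ w) z}.
Proof.
move=> Zn0; have [Z [ZZ Zd]] := dense_seq_in sP Zn0.
apply: filterS (ae_foralln (fun i => ae_energy_cvg (ZZ i))) => w h.
apply: (iterates_weak_cvg ipP maxA mB mu0 lipB tau0 gamma0 gamma_le tau_le1 tau_le2
  (xm1 := xm1 w) (fun n => res n w) _ _ ZZ Zd).
- by have [] := h 0%N.
- by have [] := h 0%N.
- by move=> i; have [] := h i.
Qed.

End Stochastic.

Theorem mainTheorem4 (R : realType) (H : completeNormedModType R)
  (ip : H -> H -> R) (d : measure_display) (Omega : measurableType d)
  (P : probability Omega R)
  (A : H -> set H) (B : H -> H) (mu : R)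
  (gm1 : R) (gamma : nat -> R)
  (xm1 : Omega -> H) (x : nat -> Omega -> H) (r : nat -> Omega -> H) :
  sep_hilbert ip ->
  maximally_monotone ip A ->
  monotone_op ip B -> 0 < mu -> lipschitz_op mu B ->
  zer A B !=set0 ->
  (* step sizes (gamma_n)_{n >= -1}, gamma_{-1} = gm1 *)
  (forall n, 0 < step_prev gm1 gamma n /\ step_prev gm1 gamma n < (Num.sqrt 2 - 1) / mu) ->
  (forall n, 0 < gamma n /\ gamma n < (Num.sqrt 2 - 1) / mu) ->
  (forall n, step_prev gm1 gamma n <= gamma n) ->
  0 < inf (range (fun n => 2 / gamma n - 1 / step_prev gm1 gamma n
                          - mu * (1 + Num.sqrt 2))) ->
  (* the reflected stochastic forward-backward iteration *)
  sq_integrable P (x 0%N) -> sq_integrable P xm1 ->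
  (forall n, condexp_H ip P (natural_filtration x n) (r n)
               (fun w => B (refl_pt xm1 x n w))) ->
  (forall n w, resolvent (gamma n) A (x n w - gamma n *: r n w) (x n.+1 w)) ->
  (* summability of the conditional variances *)
  (exists g : nat -> Omega -> \bar R,
     (forall n, condexp_nneg P (natural_filtration x n)
        (fun w => (`|r n w - B (refl_pt xm1 x n w)| ^+ 2)%:E)
        (g n)) /\
     {ae P, forall w, (\sum_(0 <= n <oo) g n w < +oo)%E}) ->
  exists xb : Omega -> H,
    [/\ H_rv xb, (forall w, zer A B (xb w))
      & {ae P, forall w, weak_cvg ip (x ^~ w) (xb w)}].
Proof.
move=> [ipP sepH] maxA mB mu0 lipB Zn0 gprev gam gmono tau0 [mx0 _] _ cond res [g [gP gsum]].
have [s sP] := separable_seq sepH.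
move: tau0; set T := (X in inf X) => tau0.
have gamma0 n : 0 < gamma n by have [] := gam n.
have infT : has_inf T.
  by apply: contrapT => nT; move: tau0; rewrite inf_out// ltxx.
have infle n : inf T <= 2 / gamma n - 1 / step_prev gm1 gamma n - mu * (1 + Num.sqrt 2).
  by apply: ge_inf; [case: infT|exists n].
have tau_le2 n : inf T + mu * (1 + Num.sqrt 2) <= 2 * (gamma n.+1)^-1 - (gamma n)^-1.
  by have := infle n.+1; rewrite /= mul1r; lra.
have tau_le1 n : inf T + mu * (1 + Num.sqrt 2) <= (gamma n)^-1.
  have := infle n; rewrite mul1r.
  have : (gamma n)^-1 <= (step_prev gm1 gamma n)^-1.
    by rewrite lef_pV2 ?posrE//; have [] := gprev n.
  by move: (_^-1) => p; lra.
have [N [mN PN sN]] := ae_iterates_weak_cvg ipP sP maxA mB mu0 lipB tau0 gamma0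
  (fun n => gmono n.+1) tau_le1 tau_le2 mx0 cond res gP gsum Zn0.
have [z0 Zz0] := Zn0.
have /choice[xb xbP] w : exists z, [/\ zer A B z, ~ N w -> weak_cvg ip (x ^~ w) z
    & N w -> z = z0].
  have [Nw|nNw] := pselect (N w); first by exists z0; split.
  have [z Zz xz] : exists2 z, zer A B z & weak_cvg ip (x ^~ w) z.
    by apply: contrapT => h; apply: nNw; exact: sN.
  by exists z; split.
exists xb; split.
- apply: (H_rv_weak_limit sP ipP (measurableC mN)
    (H_rv_iterates ipP sP maxA gamma0 mx0 cond res) (z0 := z0)).
  + by move=> w nNw; have [_ + _] := xbP w; apply.
  + by move=> w /contrapT Nw; have [_ _] := xbP w; apply.
- by move=> w; have [] := xbP w.
- exists N; split => // w /= nw; apply: contrapT => nNw; apply: nw.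
  by have [_ + _] := xbP w; apply.
Qed.
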